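(* Let $\ell,m,n\in\mathbb{N}_0$ with $m+n\ge1$ and $k=\ell+m\ge1$, and fix a word pattern of $N=\ell+m+n$ letters from $\{M,S,T\}$ with exactly $\ell$ letters $M$, $m$ letters $S$, $n$ letters $T$. Then there exist integers $a_j,b_j$ ($j=1,\dots,k$), depending only on the pattern and not on $g$, such that for every $g\in\mathcal{H}(\mathbb{D})$ the corresponding $g$-word $L\in W_g(\ell,m,n)$ satisfies $$L=(1-\delta_L)S_g^kT_g^n+\delta_LS_g^kT_g^n\Pi_0+\sum_{j=1}^ka_jS_g^{k-j}T_g^{n+j}+\sum_{j=1}^kb_jS_g^{k-j}T_g^{n+j}\Pi_0,$$ where $\delta_L=0$ if $L$ ends in $T_gM_g^i$ for some $i\in\mathbb{N}_0$ and $\delta_L=1$ if $L$ ends in $S_gM_g^i$ for some $i\in\mathbb{N}_0$. In particular, there are integers $c_j$ independent of $g$ with $$L=S_g^kT_g^n+\sum_{j=1}^kc_jS_g^{k-j}T_g^{n+j}\quad\text{on }\mathcal{H}_0(\mathbb{D}).$$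
   Context: $\mathcal{H}(\mathbb{D})$ is the space of analytic functions on the unit disc, $\mathcal{H}_0(\mathbb{D})=\{f\in\mathcal{H}(\mathbb{D}):f(0)=0\}$, and $\Pi_0f=f-f(0)$. For $g\in\mathcal{H}(\mathbb{D})$: $M_gf=gf$, $T_gf(z)=\int_0^zf(\zeta)g'(\zeta)d\zeta$, $S_gf(z)=\int_0^zf'(\zeta)g(\zeta)d\zeta$; $S_g^0,T_g^0$ are the identity. $W_g(\ell,m,n)$ is the set of products $L_1\cdots L_N$ with each $L_j\in\{M_g,S_g,T_g\}$ and exactly $\ell$, $m$, $n$ factors equal to $M_g,S_g,T_g$ respectively. ''$L$ ends in $T_gM_g^i$'' means $L=L'T_gM_g^i$ for some (possibly empty) word $L'$. *)

(* Defs.v *)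
From HB Require Import structures.
From mathcomp Require Import all_boot all_order all_algebra.
From mathcomp Require Import all_classical all_reals all_analysis.
From mathcomp Require Import complex.
Set Implicit Arguments. Unset Strict Implicit. Unset Printing Implicit Defensive.
Import Order.TTheory GRing.Theory Num.Theory.
Import numFieldNormedType.Exports.
Local Open Scope ring_scope.
Local Open Scope complex_scope.

Section Defs.
Variable R : realType.
Local Notation C := R[i].

Definition disc (z : C) : Prop := `|z| < 1.

(* H(D): holomorphic (= analytic) functions on the unit disc, i.e. complex
   differentiable at every point of D (derivative over the field C). *)
Definition holo_disc (f : C -> C) : Prop :=
  forall z : C, disc z -> derivable (f : C^o -> C^o) z 1.

Definition cderiv (f : C -> C) : C -> C := fun z => 'D_1 (f : C^o -> C^o) z.

(* the line integral int_0^z F(zeta) d zeta along the segment [0,z],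
   i.e. z * int_0^1 F(t z) dt, the real integral split into real and
   imaginary parts (Lebesgue integral on [0,1]). *)
Definition cint0 (F : C -> C) (z : C) : C :=
  z * ((Rintegral lebesgue_measure `[0%R, 1%R]%classic
           (fun t : R => complex.Re (F (t%:C * z))))
       +i* (Rintegral lebesgue_measure `[0%R, 1%R]%classic
           (fun t : R => complex.Im (F (t%:C * z))))).

Definition Mop (g f : C -> C) : C -> C := fun z => g z * f z.
Definition Top (g f : C -> C) : C -> C := cint0 (fun w => f w * cderiv g w).
Definition Sop (g f : C -> C) : C -> C := cint0 (fun w => cderiv f w * g w).
Definition Pi0 (f : C -> C) : C -> C := fun z => f z - f 0.

End Defs.

Inductive letter := LM | LS | LT.

Definition letter_eqb (a b : letter) : bool :=
  match a, b with LM, LM | LS, LS | LT, LT => true | _, _ => false end.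
Lemma letter_eqP : Equality.axiom letter_eqb.
Proof. by case; case; constructor. Qed.
HB.instance Definition _ := hasDecEq.Build letter letter_eqP.

Definition letter_op (R : realType) (g : R[i] -> R[i]) (a : letter) :
  (R[i] -> R[i]) -> (R[i] -> R[i]) :=
  match a with LM => Mop g | LS => Sop g | LT => Top g end.

Definition word_op (R : realType) (g : R[i] -> R[i]) (w : seq letter) :
  (R[i] -> R[i]) -> (R[i] -> R[i]) :=
  foldr (fun a acc => letter_op g a \o acc) id w.

Definition ends_in (w : seq letter) (a : letter) : Prop :=
  exists (w' : seq letter) (i : nat), w = w' ++ a :: nseq i LM.

(* delta_L = 1 if L ends in S_g M_g^i, and 0 if it ends in T_g M_g^i
   (when m + n >= 1 exactly one of the two cases occurs) *)
Definition delta_word (w : seq letter) : nat :=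
  if `[< ends_in w LS >] then 1%N else 0%N.

Definition opow (R : realType) (A : (R[i] -> R[i]) -> (R[i] -> R[i])) (n : nat) :=
  iter n A.

(* Main.v *)
(* All identities between M = M_g, S = S_g and T = T_g follow by comparing derivatives and
   values at 0: S M = S^2 + S T and T M = S T on H(D), M = S + T and T S = S T - T^2 on H_0(D),
   and S f = S (Pi_0 f). Hence T M^i = S^i T and S M^i = S^(i+1) Pi_0 + i S^i T, and multiplying
   a sum of terms S^(k-j) T^(n+j) on the left by a letter can be brought back to the same form
   without changing the leading coefficient, because T S = S T - T^2 moves T past S at the cost
   of terms with one S less and one T more.

   What makes T_g well behaved is that g' is again holomorphic although only the existence of g'
   is assumed. This is Goursat's theorem: integrals of F over triangles vanish by bisection, so F
   has the primitive cint0 F; shrinking a diamond around z by homotheties with centre z gives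
   Cauchy's formula in the form
     loop (F(w) / (w - z)) = F(z) * loop (1 / (w - z)),
   where the last factor is nonzero (its imaginary part is positive), and both loop integrals can
   be differentiated twice in z. *)
Require Import Defs.
From HB Require Import structures.
From mathcomp Require Import all_boot all_order all_algebra.
From mathcomp Require Import all_classical all_reals all_analysis.
From mathcomp Require Import complex.
From mathcomp Require Import ring lra.
Set Implicit Arguments. Unset Strict Implicit. Unset Printing Implicit Defensive.
Import Order.TTheory GRing.Theory Num.Theory.
Import numFieldNormedType.Exports.
Import Normc.
Local Open Scope classical_set_scope.
Local Open Scope ring_scope.
Local Open Scope complex_scope.

(** Two obstacles shape the algebra. The integers must not depend on [g], so every statement about
    normal forms chooses its coefficients before it quantifies over the operators. And [M = S + T]
    and [T S = S T - T^2] fail on functions with nonzero value at 0. A normal form can be nonzero at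
    0 only through a bare multiple of [v] itself, so one carries a sum in [f] and a sum in [Pi0 f]
    side by side: the second always vanishes at 0, and the first does once some [T] occurs or its
    leading coefficient is 0. The last letter other than [M] secures one of these two cases, and
    further letters are then added on the left. In the analysis only integrals along segments are
    available, so the contour is a polygon. Goursat's theorem is stated for convex sets, and a
    punctured neighbourhood is not convex; hence each side of the diamond is moved towards [z]
    separately, inside a half-plane that avoids [z]. The loop integral of [1 / (w - z)] is kept as a
    nonvanishing function of [z], so [F] is a quotient of two loop integrals and its derivative
    comes from the quotient rule. That derivative must be differentiated once more, which is why
    kernels up to the third power of [1 / (w - z)] occur. *)

Section ComplexNorm.
Context {R : realType}.
Implicit Types x y z : R[i].

Lemma normrE z : `|z| = (normc z)%:C. Proof. by []. Qed.

Lemma discE z : disc z <-> normc z < 1.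
Proof. by rewrite /disc normrE ltcR. Qed.

Lemma normc_ge0 z : 0 <= normc z.
Proof. by rewrite -lecR -normrE normr_ge0. Qed.

Lemma normc_gt0 z : (0 < normc z) = (z != 0).
Proof. by rewrite -ltcR -normrE normr_gt0. Qed.

Lemma normcD x y : normc (x + y) <= normc x + normc y.
Proof. exact: le_normcD. Qed.

Lemma normcB x y : normc (x - y) <= normc x + normc y.
Proof. by rewrite -[normc y]normcN; exact: le_normcD. Qed.

Lemma normcBC x y : normc (x - y) = normc (y - x).
Proof. by rewrite -normcN opprB. Qed.

Lemma normcR (a : R) : normc a%:C = `|a|.
Proof. by rewrite /= expr0n addr0 sqrtr_sqr. Qed.

Lemma normc_Re z : `|complex.Re z| <= normc z.
Proof.
case: z => a b /=; rewrite -sqrtr_sqr ler_sqrt ?lerDl ?sqr_ge0 //.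
by rewrite addr_ge0 ?sqr_ge0.
Qed.

Lemma normc_Im z : `|complex.Im z| <= normc z.
Proof.
case: z => a b /=; rewrite -sqrtr_sqr ler_sqrt ?lerDr ?sqr_ge0 //.
by rewrite addr_ge0 ?sqr_ge0.
Qed.

Lemma normc_le_ReIm z : normc z <= `|complex.Re z| + `|complex.Im z|.
Proof.
rewrite {1}[z]complexE.
apply: le_trans (normcD _ _) _.
rewrite normcM !normcR. have -> : normc ('i : R[i]) = 1 by rewrite /= expr0n expr1n add0r sqrtr1.
by rewrite mul1r.
Qed.

Lemma normc_le_eps_eq0 z (c : R) : 0 <= c -> (forall e, 0 < e -> normc z <= c * e) -> z = 0.
Proof.
move=> c0 H; apply: eq0_normc; apply/eqP; rewrite eq_le normc_ge0 andbT.
rewrite leNgt; apply/negP => z0.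
(* The [c + 1] keeps the divisor positive when [c = 0]; the bound then becomes at most half of
   [normc z]. *)
have := H (normc z / (c + 1) / 2).
have c1 : 0 < c + 1 by lra.
move=> /(_ ltac:(by rewrite !divr_gt0)).
move=> H1.
have : c * (normc z / (c + 1) / 2) <= normc z / 2.
  rewrite !mulrA ler_pM2r ?invr_gt0 ?ltr0n // ler_pdivrMr //; nra.
lra.
Qed.

End ComplexNorm.

(** * Complex differentiability and continuity in epsilon form *)

Section ComplexDerivative.
Context {R : realType}.
Implicit Types (F G : R[i] -> R[i]) (z d : R[i]).

Definition cder F z d := is_derive (z : R[i]^o) 1 (F : R[i]^o -> R[i]^o) d.

(** Clearing the denominator of the difference quotient removes the puncture at [h = 0], and real
    [e] and [r] turn all later estimates into inequalities over [R]. *)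
Lemma cderP F z d : cder F z d <->
  forall e : R, 0 < e -> exists2 r : R, 0 < r &
    forall h, normc h < r -> normc (F (z + h) - F z - d * h) <= e * normc h.
Proof.
split.
- move=> [dF <-] e e0; move: dF => /cvgrPdist_lt.
  move=> /(_ e%:C); rewrite ltcR => /(_ e0).
  rewrite /= -/('D_1 (F : R[i]^o -> R[i]^o) z).
  move=> [r /= r0 H].
  exists (complex.Re r).
    by move: r0; rewrite ltcE => /andP[].
  move=> h hr.
  have [->|h0] := eqVneq h 0.
    by rewrite addr0 subrr mulr0 subr0 normc0 mulr0.
  have := H h; rewrite /ball_ /= sub0r normrN normrE.
  (* In the order of [R[i]], [0 < r] forces the imaginary part of [r] to be 0, so its real part is
     the radius. *)
  have -> : (normc h)%:C < r.
    by move: r0; rewrite !ltcE /= => /andP[/eqP -> _]; rewrite eqxx hr.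
  move=> /(_ isT h0).
  rewrite normrE ltcR => /ltW H1.
  have -> : F (z + h) - F z - 'D_1 (F : R[i]^o -> R[i]^o) z * h =
    - (h * ('D_1 (F : R[i]^o -> R[i]^o) z - h^-1 *: ((F (h *: 1 + z) - F z)))).
    rewrite scaler1 (addrC h z) mulrBr [h * (_ *: _)]mulrA mulfV // mul1r; ring.
  by rewrite normcN normcM mulrC ler_wpM2r ?normc_ge0.
- move=> H.
  have K : h^-1 *: (((F : R[i]^o -> R[i]^o) \o shift z) (h *: 1) - F z)
      @[h --> (0 : (R[i] : numFieldType))^'] --> (d : R[i]^o).
    apply/cvgrPdist_le => e e0.
    have eE : e = (complex.Re e)%:C by rewrite RRe_real // ger0_real // ltW.
    have e0' : 0 < complex.Re e by rewrite -ltcR -eE.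
    have [r r0 Hr] := H _ e0'.
    exists r%:C => /=; first by rewrite ltcR.
    move=> h /=; rewrite sub0r normrN normrE ltcR => hr h0.
    rewrite eE normrE lecR scaler1 (addrC h z).
    have hn : 0 < normc h by rewrite normc_gt0.
    rewrite -(ler_pM2r hn) -normcM.
    have -> : (d - h^-1 *: (F (z + h) - F z)) * h = - (F (z + h) - F z - d * h).
      rewrite mulrBl -[h^-1 *: _]/(h^-1 * _) [h^-1 * _ * h]mulrAC mulVf // mul1r. ring.
    by rewrite normcN; apply: Hr.
  split; first by apply/cvg_ex; exists d.
  exact: cvg_lim K.
Qed.

End ComplexDerivative.

Section ComplexDerivativeRules.
Context {R : realType}.
Implicit Types (F G : R[i] -> R[i]) (z d : R[i]).

Lemma cder_eq F z d e : cder F z d -> d = e -> cder F z e.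
Proof. by move=> h <-. Qed.

Lemma cder_near F G z d : (exists2 r : R, 0 < r & forall w, normc (w - z) < r -> F w = G w) ->
  cder F z d -> cder G z d.
Proof.
move=> [r r0 H] /cderP K; apply/cderP => e e0.
have [q q0 Hq] := K e e0; exists (Num.min q r); first by rewrite lt_min q0.
move=> h; rewrite lt_min => /andP[hq hr].
rewrite -(H (z + h)); last by rewrite addrC addKr.
rewrite -(H z); last by rewrite subrr normc0.
exact: Hq.
Qed.

Lemma cder_cst c z : cder (fun=> c) z 0.
Proof. exact: is_derive_cst. Qed.

Lemma cder_id z : cder id z 1.
Proof. exact: is_derive_id. Qed.

Lemma cderD F G z d e : cder F z d -> cder G z e -> cder (fun w => F w + G w) z (d + e).
Proof. exact: is_deriveD. Qed.

Lemma cderN F z d : cder F z d -> cder (fun w => - F w) z (- d).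
Proof. exact: is_deriveN. Qed.

Lemma cderB F G z d e : cder F z d -> cder G z e -> cder (fun w => F w - G w) z (d - e).
Proof. by move=> h k; apply: cderD => //; exact: cderN. Qed.

Lemma cderM F G z d e : cder F z d -> cder G z e ->
  cder (fun w => F w * G w) z (d * G z + F z * e).
Proof.
move=> h k; apply: cder_eq (is_deriveM h k) _.
by rewrite addrC -[_ *: d]/(_ * d) -[_ *: e]/(_ * e) (mulrC d).
Qed.

Lemma cderMl c F z d : cder F z d -> cder (fun w => c * F w) z (c * d).
Proof. by move=> h; apply: cder_eq (cderM (cder_cst c z) h) _; rewrite mul0r add0r. Qed.

Lemma cderV F z d : F z != 0 -> cder F z d -> cder (fun w => (F w)^-1) z (- (d / (F z ^+ 2))).
Proof.
move=> F0 [h1 h2]; split; first exact: derivableV.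
rewrite deriveV // h2 -[_ *: _]/(_ * _).
by rewrite mulNr mulrC.
Qed.

Definition ccont F z := forall e : R, 0 < e -> exists2 r : R, 0 < r &
  forall w, normc (w - z) < r -> normc (F w - F z) <= e.

Lemma cder_cont F z d : cder F z d -> ccont F z.
Proof.
move=> /cderP /(_ 1 ltr01) [r r0 H] e e0.
have c0 : 0 < 1 + normc d by rewrite ltr_wpDr ?normc_ge0.
exists (Num.min r (e / (1 + normc d))); first by rewrite lt_min r0 divr_gt0.
move=> w; rewrite lt_min => /andP[w1].
rewrite ltr_pdivlMr // => w2.
have := H _ w1; rewrite [z + _]addrC subrK mul1r => H1.
have -> : F w - F z = (F w - F z - d * (w - z)) + d * (w - z) by ring.
apply: le_trans (normcD _ _) _; rewrite normcM; nra.
Qed.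

End ComplexDerivativeRules.

(** * Integration over [0, 1] and over segments *)
Section Integral01.
Context {R : realType}.
Implicit Types (f g P : R -> R).

Notation cont01 f := (forall t : R, 0 <= t <= 1 -> {for t, continuous f}).
Notation prim01 f P := (forall t : R, 0 <= t <= 1 -> is_derive (t : R) (1 : R) P (f t)).

Definition int01 f : R := Rintegral lebesgue_measure `[0%R, 1%R] f.

(** The primitive has to be differentiable from both sides at 0 and 1, so [f] is extended
    continuously to the whole line by a clamp, and the integral starts at -1, strictly left of the
    interval. *)
Lemma cont01_prim f : cont01 f -> exists P : R -> R, prim01 f P.
Proof.
(* [cl] is the clamp to [0, 1], written with absolute values so that its continuity is immediate. *)
move=> cf; pose cl (t : R) := (1 + `|t| - `|t - 1|) * 2^-1.
have clE t : 0 <= t <= 1 -> cl t = t.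
  move=> /andP[t0 t1]; rewrite /cl (ger0_norm t0) ler0_norm; last by lra.
  by field.
have cl01 t : 0 <= cl t <= 1.
  have h1 : `|t - 1| <= `|t| + 1 by have := ler_normB t 1; rewrite normr1.
  have h2 : `|t| <= `|t - 1| + 1.
    by have := ler_normD (t - 1) 1; rewrite normr1 subrK.
  by rewrite /cl; lra.
have ccl : continuous cl.
  move=> t; apply: cvgMr_tmp; apply: cvgB.
    by apply: cvgD; [exact: cvg_cst|apply: cvg_norm; exact: cvg_id].
  by apply: cvg_norm; apply: cvgB; [exact: cvg_id|exact: cvg_cst].
pose fc := f \o cl.
have cfc : continuous fc.
  move=> t; apply: continuous_comp; first exact: ccl.
  exact/cf/cl01.
have ifc : lebesgue_measure.-integrable `[(-1:R), 3] (EFin \o fc).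
  apply: continuous_compact_integrable; first exact: segment_compact.
  exact: continuous_subspaceT.
pose P (x : R) := (\int[lebesgue_measure]_(t in `[(-1:R), x]) fc t)%R.
exists P => t t01.
have [dF F'] : derivable P t 1 /\ derive1 P t = fc t.
  apply: (@continuous_FTC1_closed _ fc (-1) t 3) => //; last exact: cfc.
  - by lra.
  - by lra.
by split=> //; rewrite -derive1E F' /fc /= clE.
Qed.

Lemma int01E f P : cont01 f -> prim01 f P -> int01 f = P 1 - P 0.
Proof.
move=> cf dP.
have cP t : 0 <= t <= 1 -> {for t, continuous P}.
  move=> t01; apply: differentiable_continuous; apply/derivable1_diffP.
  by have [] := dP t t01.
rewrite /int01 /Rintegral (@continuous_FTC2 _ f P 0 1) //.
- apply: continuous_in_subspaceT => x.
  by rewrite inE /= in_itv /=; exact: cf.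
- split.
  + move=> x; rewrite in_itv /= => /andP[x0 x1].
    by have [] : is_derive x 1 P (f x) by apply: dP; rewrite !ltW.
  + by apply: cvg_at_right_filter; apply: cP; rewrite lexx ler01.
  + by apply: cvg_at_left_filter; apply: cP; rewrite lexx ler01.
- move=> x; rewrite in_itv /= => /andP[x0 x1].
  rewrite derive1E.
  by have [_ ->] : is_derive x 1 P (f x) by apply: dP; rewrite !ltW.
Qed.

Lemma eq_int01 f g : (forall t, 0 <= t <= 1 -> f t = g t) -> int01 f = int01 g.
Proof.
by move=> H; apply: eq_Rintegral => t; rewrite inE /= in_itv /=; exact: H.
Qed.

Lemma le_int01 f g : cont01 f -> cont01 g ->
  (forall t, 0 <= t <= 1 -> f t <= g t) -> int01 f <= int01 g.
Proof.
move=> cf cg H.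
have itg h : cont01 h -> lebesgue_measure.-integrable `[(0:R), 1] (EFin \o h).
  move=> ch; apply: continuous_compact_integrable; first exact: segment_compact.
  by apply: continuous_in_subspaceT => x; rewrite inE /= in_itv /=; exact: ch.
apply: le_Rintegral => //; try exact: itg.
Qed.

Lemma int01_cst (c : R) : int01 (fun=> c) = c.
Proof.
have h1 (t : R) : 0 <= t <= 1 -> {for t, continuous (fun _ : R => c)}.
  by move=> _; exact: cst_continuous.
have h2 (t : R) : 0 <= t <= 1 -> is_derive (t : R) (1 : R) (fun s => c * s) c.
  move=> _; have := is_deriveZ c (is_derive_id t (1:R)).
  by rewrite -[c *: 1]/(c * 1) mulr1.
by rewrite (int01E h1 h2) mulr1 mulr0 subr0.
Qed.

End Integral01.

Section ComplexIntegral01.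
Context {R : realType}.
Implicit Types (phi psi P Q : R -> R[i]) (t : R).

Lemma is_derive_eps (f : R -> R) t (d : R) :
  (forall e : R, 0 < e -> exists2 r : R, 0 < r &
    forall h, `|h| < r -> `|f (t + h) - f t - d * h| <= e * `|h|) ->
  is_derive (t : R) (1 : R) f d.
Proof.
move=> H.
have K : h^-1 *: ((f \o shift t) (h *: 1) - f t) @[h --> (0 : R)^'] --> d.
  apply/cvgrPdist_le => e e0.
  have [r r0 Hr] := H _ e0.
  exists r => //= h /=; rewrite sub0r normrN => hr h0.
  have hn : 0 < `|h| by rewrite normr_gt0.
  rewrite -(ler_pM2r hn) -normrM.
  have -> : (d - h^-1 *: (f (h *: 1 + t) - f t)) * h = - (f (t + h) - f t - d * h).
    rewrite -[h *: 1]/(h * 1) mulr1 (addrC h t) mulrBl -[h^-1 *: _]/(h^-1 * _).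
    by rewrite [h^-1 * _ * h]mulrAC mulVf // mul1r; ring.
  by rewrite normrN; apply: Hr.
split; first by apply/cvg_ex; exists d.
exact: cvg_lim K.
Qed.

Definition pcont phi t := forall e : R, 0 < e -> exists2 r : R, 0 < r &
  forall s, `|s - t| < r -> normc (phi s - phi t) <= e.

Definition pcont01 phi := forall t, 0 <= t <= 1 -> pcont phi t.

Definition cprim phi P := forall t, 0 <= t <= 1 ->
  is_derive (t : R) (1 : R) (fun s => complex.Re (P s)) (complex.Re (phi t)) /\
  is_derive (t : R) (1 : R) (fun s => complex.Im (P s)) (complex.Im (phi t)).

Definition cI phi : R[i] :=
  int01 (fun t => complex.Re (phi t)) +i* int01 (fun t => complex.Im (phi t)).

Lemma RecB (x y : R[i]) : complex.Re (x - y) = complex.Re x - complex.Re y.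
Proof. by case: x y => [? ?] [? ?]. Qed.
Lemma ImcB (x y : R[i]) : complex.Im (x - y) = complex.Im x - complex.Im y.
Proof. by case: x y => [? ?] [? ?]. Qed.
Lemma RecD (x y : R[i]) : complex.Re (x + y) = complex.Re x + complex.Re y.
Proof. by case: x y => [? ?] [? ?]. Qed.
Lemma ImcD (x y : R[i]) : complex.Im (x + y) = complex.Im x + complex.Im y.
Proof. by case: x y => [? ?] [? ?]. Qed.
Lemma RecN (x : R[i]) : complex.Re (- x) = - complex.Re x.
Proof. by case: x. Qed.
Lemma ImcN (x : R[i]) : complex.Im (- x) = - complex.Im x.
Proof. by case: x. Qed.
Lemma RecM (x y : R[i]) : complex.Re (x * y) =
  complex.Re x * complex.Re y - complex.Im x * complex.Im y.
Proof. by case: x y => [? ?] [? ?]. Qed.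
Lemma ImcM (x y : R[i]) : complex.Im (x * y) =
  complex.Re x * complex.Im y + complex.Im x * complex.Re y.
Proof. by case: x y => [? ?] [? ?]. Qed.

Lemma complex_ext (x y : R[i]) : complex.Re x = complex.Re y ->
  complex.Im x = complex.Im y -> x = y.
Proof. by case: x y => [? ?] [? ?] /= -> ->. Qed.

Lemma pcont_Re phi t : pcont phi t -> {for t, continuous (fun s => complex.Re (phi s))}.
Proof.
move=> H; apply/cvgrPdist_le => e e0; have [r r0 Hr] := H e e0.
exists r => //= s; rewrite /ball_ /= distrC => hs.
by rewrite -RecB; apply: le_trans (normc_Re _) _; rewrite normcBC; exact: Hr.
Qed.

Lemma pcont_Im phi t : pcont phi t -> {for t, continuous (fun s => complex.Im (phi s))}.
Proof.
move=> H; apply/cvgrPdist_le => e e0; have [r r0 Hr] := H e e0.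
exists r => //= s; rewrite /ball_ /= distrC => hs.
by rewrite -ImcB; apply: le_trans (normc_Im _) _; rewrite normcBC; exact: Hr.
Qed.

Lemma cprim_ex phi : pcont01 phi -> exists P, cprim phi P.
Proof.
move=> c.
have [P HP] := cont01_prim (fun t ht => pcont_Re (c t ht)).
have [Q HQ] := cont01_prim (fun t ht => pcont_Im (c t ht)).
by exists (fun t => P t +i* Q t) => t ht; split; [exact: HP|exact: HQ].
Qed.

(** Additivity, complex scaling and affine substitution are all read off from this formula, since
    the corresponding rules for primitives are elementary. *)
Lemma cIE phi P : pcont01 phi -> cprim phi P -> cI phi = P 1 - P 0.
Proof.
move=> c p; rewrite /cI.
rewrite (int01E (fun t ht => pcont_Re (c t ht)) (fun t ht => (p t ht).1)).
rewrite (int01E (fun t ht => pcont_Im (c t ht)) (fun t ht => (p t ht).2)).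
by apply: complex_ext; rewrite ?RecB ?ImcB.
Qed.

Lemma eq_cI phi psi : (forall t, 0 <= t <= 1 -> phi t = psi t) -> cI phi = cI psi.
Proof. by move=> H; congr (_ +i* _); apply: eq_int01 => t /H ->. Qed.

Lemma pcontD phi psi t : pcont phi t -> pcont psi t -> pcont (fun s => phi s + psi s) t.
Proof.
move=> c1 c2 e e0.
have e2 : 0 < e / 2 by lra.
have [r r0 Hr] := c1 _ e2; have [q q0 Hq] := c2 _ e2.
exists (Num.min r q); first by rewrite lt_min r0.
move=> s; rewrite lt_min => /andP[h1 h2].
have -> : phi s + psi s - (phi t + psi t) = (phi s - phi t) + (psi s - psi t) by ring.
apply: le_trans (normcD _ _) _; have := Hr _ h1; have := Hq _ h2; lra.
Qed.

Lemma pcontMl c phi t : pcont phi t -> pcont (fun s => c * phi s) t.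
Proof.
move=> c1 e e0.
have c0 : 0 < 1 + normc c by rewrite ltr_wpDr ?normc_ge0.
have [r r0 Hr] := c1 (e / (1 + normc c)) (divr_gt0 e0 c0).
exists r => // s /Hr; rewrite ler_pdivlMr // -mulrBr normcM => H.
have := normc_ge0 (phi s - phi t); nra.
Qed.

Lemma pcont_aff phi (c d t : R) : pcont phi (c + d * t) -> pcont (fun s => phi (c + d * s)) t.
Proof.
move=> c1 e e0.
have [r r0 Hr] := c1 e e0.
have c0 : 0 < 1 + `|d| by rewrite ltr_wpDr.
exists (r / (1 + `|d|)); first exact: divr_gt0.
move=> s; rewrite ltr_pdivlMr // => hs; apply: Hr.
have -> : c + d * s - (c + d * t) = d * (s - t) by ring.
rewrite normrM; have := normr_ge0 (s - t); nra.
Qed.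

Lemma cprimD phi psi P Q : cprim phi P -> cprim psi Q ->
  cprim (fun t => phi t + psi t) (fun t => P t + Q t).
Proof.
move=> p q t ht; have [p1 p2] := p t ht; have [q1 q2] := q t ht.
rewrite RecD ImcD; split.
- under [fun s => _]eq_fun do rewrite RecD; exact: is_deriveD.
- under [fun s => _]eq_fun do rewrite ImcD; exact: is_deriveD.
Qed.

Lemma cprimMl c phi P : cprim phi P -> cprim (fun t => c * phi t) (fun t => c * P t).
Proof.
move=> p t ht; have [p1 p2] := p t ht.
rewrite RecM ImcM; split.
- under [fun s => _]eq_fun do rewrite RecM.
  exact: (is_deriveB (is_deriveZ (complex.Re c) p1) (is_deriveZ (complex.Im c) p2)).
- under [fun s => _]eq_fun do rewrite ImcM.
  exact: (is_deriveD (is_deriveZ (complex.Re c) p2) (is_deriveZ (complex.Im c) p1)).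
Qed.

Lemma cprim_aff phi P (c d : R) : (forall t, 0 <= t <= 1 -> 0 <= c + d * t <= 1) ->
  cprim phi P -> cprim (fun t => d%:C * phi (c + d * t)) (fun t => P (c + d * t)).
Proof.
move=> cd p t ht; have [p1 p2] := p _ (cd _ ht).
have D : is_derive (t : R) (1 : R) (fun s : R => c + d * s) d.
  have := is_deriveD (is_derive_cst c (t:R) (1:R)) (is_deriveZ d (is_derive_id t (1:R))).
  by rewrite -[d *: 1]/(d * 1) mulr1 add0r.
rewrite RecM ImcM /= !mul0r subr0 addr0 [d * complex.Re _]mulrC [d * complex.Im _]mulrC; split.
- exact: (@is_derive1_comp _ _ (fun s : R => c + d * s) _ _ _ p1 D).
- exact: (@is_derive1_comp _ _ (fun s : R => c + d * s) _ _ _ p2 D).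
Qed.

Lemma cID phi psi : pcont01 phi -> pcont01 psi ->
  cI (fun t => phi t + psi t) = cI phi + cI psi.
Proof.
move=> c1 c2; have [P p] := cprim_ex c1; have [Q q] := cprim_ex c2.
rewrite (cIE c1 p) (cIE c2 q) (cIE _ (cprimD p q)); first by ring.
by move=> t ht; apply: pcontD; [exact: c1|exact: c2].
Qed.

Lemma cIMl c phi : pcont01 phi -> cI (fun t => c * phi t) = c * cI phi.
Proof.
move=> c1; have [P p] := cprim_ex c1.
rewrite (cIE c1 p) (cIE _ (cprimMl c p)); first by ring.
by move=> t ht; apply: pcontMl; exact: c1.
Qed.

(** Substitution with no sign condition on [d]: [d = -1] serves to reverse a segment and [d = 1/2]
    to halve it. *)
Lemma cI_aff phi P (c d : R) : (forall t, 0 <= t <= 1 -> 0 <= c + d * t <= 1) ->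
  pcont01 phi -> cprim phi P ->
  d%:C * cI (fun t => phi (c + d * t)) = P (c + d) - P c.
Proof.
move=> cd c1 p.
have c2 : pcont01 (fun t => phi (c + d * t)).
  by move=> t ht; apply: pcont_aff; apply: c1; exact: cd.
rewrite -cIMl // (cIE _ (cprim_aff cd p)) ?mulr1 ?mulr0 ?addr0 //.
by move=> t ht; apply: pcontMl; exact: c2.
Qed.

(** Real and imaginary parts are bounded separately, whence the factor 2. It reappears in the
    constants of all later length estimates. *)
Lemma normc_cI phi (M : R) : pcont01 phi ->
  (forall t, 0 <= t <= 1 -> normc (phi t) <= M) -> normc (cI phi) <= 2 * M.
Proof.
move=> c1 H.
have cR := fun t ht => pcont_Re (c1 t ht); have cJ := fun t ht => pcont_Im (c1 t ht).
have hR t : 0 <= t <= 1 -> - M <= complex.Re (phi t) <= M.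
  by move=> /H h; have := le_trans (normc_Re _) h; rewrite ler_norml.
have hJ t : 0 <= t <= 1 -> - M <= complex.Im (phi t) <= M.
  by move=> /H h; have := le_trans (normc_Im _) h; rewrite ler_norml.
apply: le_trans (normc_le_ReIm _) _ => /=.
have -> : 2 * M = M + M by ring.
have key f : (forall t, 0 <= t <= 1 -> {for t, continuous f}) ->
    (forall t, 0 <= t <= 1 -> - M <= f t <= M) -> `|int01 f| <= M.
  move=> cf hf; rewrite ler_norml; apply/andP; split.
    rewrite -(int01_cst (- M)); apply: le_int01 => // [t _|t /hf/andP[]//].
    exact: cst_continuous.
  rewrite -[leRHS]int01_cst; apply: le_int01 => // [t _|t /hf/andP[]//].
  exact: cst_continuous.
  by apply: lerD; apply: key.
Qed.

End ComplexIntegral01.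

Section SegmentIntegral.
Context {R : realType}.
Implicit Types (F G H : R[i] -> R[i]) (a b c z : R[i]).

Definition spt a b (t : R) : R[i] := a + t%:C * (b - a).

Definition seg a b F : R[i] := (b - a) * cI (fun t => F (spt a b t)).

Definition segcont a b F := forall t : R, 0 <= t <= 1 -> ccont F (spt a b t).

Lemma spt0 a b : spt a b 0 = a.
Proof. by rewrite /spt mul0r addr0. Qed.

Lemma spt1 a b : spt a b 1 = b.
Proof. by rewrite /spt mul1r addrC subrK. Qed.

Lemma cint0E F z : cint0 F z = seg 0 z F.
Proof.
rewrite /cint0 /seg subr0; congr (_ * _).
by congr (_ +i* _); apply: eq_int01 => t _; rewrite /spt subr0 add0r.
Qed.

Lemma segcont_pcont a b F : segcont a b F -> pcont01 (fun t => F (spt a b t)).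
Proof.
move=> c t ht e e0; have [r r0 Hr] := c t ht e e0.
have c0 : 0 < 1 + normc (b - a) by rewrite ltr_wpDr ?normc_ge0.
exists (r / (1 + normc (b - a))); first exact: divr_gt0.
move=> s; rewrite ltr_pdivlMr // => hs; apply: Hr.
have -> : spt a b s - spt a b t = (s - t)%:C * (b - a) by rewrite /spt rmorphB; ring.
rewrite normcM normcR; have := normr_ge0 (s - t); nra.
Qed.

Lemma eq_seg a b F G : (forall t : R, 0 <= t <= 1 -> F (spt a b t) = G (spt a b t)) ->
  seg a b F = seg a b G.
Proof. by move=> h; congr (_ * _); exact: eq_cI. Qed.

Lemma segD a b F G : segcont a b F -> segcont a b G ->
  seg a b (fun w => F w + G w) = seg a b F + seg a b G.
Proof. by move=> /segcont_pcont f /segcont_pcont g; rewrite /seg cID // mulrDr. Qed.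

Lemma segMl a b c F : segcont a b F -> seg a b (fun w => c * F w) = c * seg a b F.
Proof. by move=> /segcont_pcont f; rewrite /seg cIMl // mulrCA. Qed.

Lemma seg_rev a b F : segcont a b F -> seg b a F = - seg a b F.
Proof.
move=> /segcont_pcont c; have [P p] := cprim_ex c.
have h (t : R) : 0 <= t <= 1 -> 0 <= 1 + -1 * t <= 1 by lra.
have := cI_aff h c p; rewrite subrr rmorphN1 mulN1r.
rewrite {2}/seg (cIE c p) -mulrN opprB => <-.
rewrite /seg mulrN -mulNr opprB; congr (_ * _); apply: eq_cI => t _.
by congr F; rewrite /spt rmorphD rmorph1 mulN1r rmorphN; ring.
Qed.

Lemma seg_mid a b F : segcont a b F ->
  seg a b F = seg a ((a + b) / 2) F + seg ((a + b) / 2) b F.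
Proof.
move=> /segcont_pcont c; have [P p] := cprim_ex c.
have h1 (t : R) : 0 <= t <= 1 -> 0 <= 0 + 2^-1 * t <= 1 by lra.
have h2 (t : R) : 0 <= t <= 1 -> 0 <= 2^-1 + 2^-1 * t <= 1 by lra.
have := cI_aff h1 c p; rewrite add0r => e1.
have := cI_aff h2 c p.
have -> : 2^-1 + 2^-1 = 1 :> R by lra.
move=> e2.
have i2 : (2^-1 : R)%:C = 2^-1 by rewrite fmorphV rmorph_nat.
rewrite {1}/seg (cIE c p).
have -> : P 1 - P 0 = (P 1 - P (2^-1)) + (P (2^-1) - P 0) by ring.
rewrite -e1 -e2 i2 /seg mulrDr addrC !mulrA; congr (_ * _ + _ * _).
- by field.
- by apply: eq_cI => t _; congr F; rewrite /spt add0r rmorphM /= i2; field.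
- by field.
- by apply: eq_cI => t _; congr F; rewrite /spt rmorphD rmorphM /= i2; field.
Qed.

Lemma normc_seg a b F (M : R) : segcont a b F ->
  (forall t : R, 0 <= t <= 1 -> normc (F (spt a b t)) <= M) ->
  normc (seg a b F) <= 2 * M * normc (b - a).
Proof.
move=> /segcont_pcont c h; rewrite /seg normcM mulrC.
by rewrite ler_wpM2r ?normc_ge0 //; exact: normc_cI.
Qed.

(** The chain rule along a segment: a real increment [h] moves the point by [h * (b - a)], and the
    complex remainder bounds the remainders of both components. *)
Lemma cprim_seg a b F H :
  (forall t : R, 0 <= t <= 1 -> cder H (spt a b t) (F (spt a b t))) ->
  cprim (fun t => (b - a) * F (spt a b t)) (fun t => H (spt a b t)).
Proof.
move=> D t ht; have /cderP K := D t ht.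
set v : R[i] := b - a; have c0 : 0 < 1 + normc v by rewrite ltr_wpDr ?normc_ge0.
have key (e : R) : 0 < e -> exists2 r : R, 0 < r & forall h : R, `|h| < r ->
    normc (H (spt a b (t + h)) - H (spt a b t) - (v * F (spt a b t)) * h%:C) <= e * `|h|.
  move=> e0; have [r r0 Hr] := K _ (divr_gt0 e0 c0).
  exists (r / (1 + normc v)); first exact: divr_gt0.
  move=> h; rewrite ltr_pdivlMr // => hs.
  have hv : normc (h%:C * v) <= `|h| * (1 + normc v).
    rewrite normcM normcR; have := normr_ge0 h; nra.
  have := Hr _ (le_lt_trans hv hs).
  have -> : spt a b t + h%:C * v = spt a b (t + h) by rewrite /spt rmorphD -/v; ring.
  have -> : F (spt a b t) * (h%:C * v) = v * F (spt a b t) * h%:C by ring.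
  move=> h1; apply: le_trans h1 _.
  apply: le_trans (ler_wpM2l _ hv) _; first by rewrite ltW // divr_gt0.
  by rewrite mulrCA [_ * (1 + _)]divfK ?gt_eqF // mulrC.
split; apply: is_derive_eps => e /key [r r0 Hr]; exists r => // h /Hr; apply: le_trans.
- apply: le_trans _ (normc_Re _); rewrite le_eqVlt; apply/predU1l; congr `|_|.
by rewrite !RecB; congr (_ - _); rewrite [RHS]RecM /= mulr0 subr0.
- apply: le_trans _ (normc_Im _); rewrite le_eqVlt; apply/predU1l; congr `|_|.
  by rewrite !ImcB; congr (_ - _); rewrite [RHS]ImcM /= mulr0 add0r.
Qed.

Lemma seg_FTC a b F H : segcont a b F ->
  (forall t : R, 0 <= t <= 1 -> cder H (spt a b t) (F (spt a b t))) ->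
  seg a b F = H b - H a.
Proof.
move=> /segcont_pcont c D.
rewrite /seg -cIMl // (cIE _ (cprim_seg D)) ?spt0 ?spt1 //.
by move=> t ht; apply: pcontMl; exact: c.
Qed.

End SegmentIntegral.

(** * Goursat's theorem *)
Section Goursat.
Context {R : realType}.
Implicit Types (F G H : R[i] -> R[i]) (a b c z p : R[i]) (K : R[i] -> Prop).

Lemma ex_div_exp2_lt (x r : R) : 0 < r -> exists n, x / 2 ^+ n < r.
Proof.
move=> r0; pose n := Num.bound `|x / r|; exists n.
have p2 : 0 < 2 ^+ n :> R by rewrite exprn_gt0.
rewrite ltr_pdivrMr // mulrC -ltr_pdivrMr //.
apply: le_lt_trans (ler_norm _) _; apply: lt_le_trans (archi_boundP (normr_ge0 _)) _.
by rewrite -natrX ler_nat ltnW // ltn_expl.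
Qed.

(** The radius [D n = 2 * d / 2 ^+ n] is the sum of all steps from [n] on, so the intervals of
    centre [x n] and radius [D n] are nested; the supremum of their left ends lies in all of
    them. *)
Lemma dyadic_limit_real (x : nat -> R) (d : R) :
  (forall n, `|x n.+1 - x n| <= d / 2 ^+ n) ->
  exists p : R, forall n, `|x n - p| <= 2 * d / 2 ^+ n.
Proof.
move=> hx; pose D n := 2 * d / 2 ^+ n.
have d0 : 0 <= d by have := hx 0; rewrite expr0 divr1; apply: le_trans.
have DS n : D n = d / 2 ^+ n + D n.+1.
  by rewrite /D exprS; field; rewrite expf_neq0.
have D0 n : 0 <= D n by rewrite /D divr_ge0 ?mulr_ge0 // exprn_ge0.
pose u n := x n - D n; pose v n := x n + D n.
have uS n : u n <= u n.+1.
  by have := hx n; rewrite ler_norml /u (DS n) => /andP[]; lra.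
have vS n : v n.+1 <= v n.
  by have := hx n; rewrite ler_norml /v (DS n) => /andP[]; lra.
have uM m n : (m <= n)%N -> u m <= u n.
  by apply: (homo_leq_in lexx le_trans) => // i _ _ _; exact: uS.
have vM m n : (m <= n)%N -> v n <= v m.
  elim: n => [|n IH]; first by rewrite leqn0 => /eqP ->.
  rewrite leq_eqVlt => /orP[/eqP ->//|]; rewrite ltnS => /IH; exact: le_trans.
have uv m n : u m <= v n.
  apply: le_trans (uM m (maxn m n) _) _; first exact: leq_maxl.
  apply: le_trans _ (vM n (maxn m n) _); last exact: leq_maxr.
  by rewrite /u /v; have := D0 (maxn m n); lra.
exists (sup (range u)) => n.
have h1 : u n <= sup (range u).
  by apply: ub_le_sup; [exists (v 0) => _ [m _ <-]; exact: uv|exists n].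
have h2 : sup (range u) <= v n.
  by apply: ge_sup; [exists (u 0), 0|move=> _ [m _ <-]; exact: uv].
by move: h1 h2; rewrite ler_norml /u /v -/(D n); lra.
Qed.

Lemma dyadic_limit (x : nat -> R[i]) (d : R) :
  (forall n, normc (x n.+1 - x n) <= d / 2 ^+ n) ->
  exists p, forall n, normc (x n - p) <= 4 * d / 2 ^+ n.
Proof.
move=> hx.
have [p hp] : exists p : R, forall n, `|complex.Re (x n) - p| <= 2 * d / 2 ^+ n.
  apply: dyadic_limit_real => n; rewrite -RecB.
  exact: le_trans (normc_Re _) (hx n).
have [q hq] : exists p : R, forall n, `|complex.Im (x n) - p| <= 2 * d / 2 ^+ n.
  apply: dyadic_limit_real => n; rewrite -ImcB.
  exact: le_trans (normc_Im _) (hx n).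
exists (p +i* q) => n; apply: le_trans (normc_le_ReIm _) _.
rewrite RecB ImcB /=; have := hp n; have := hq n.
have -> : 4 * d / 2 ^+ n = 2 * d / 2 ^+ n + 2 * d / 2 ^+ n.
  by field; rewrite expf_neq0.
by move=> h1 h2; exact: lerD.
Qed.

Definition cconvex K := forall a b (t : R), K a -> K b -> 0 <= t <= 1 -> K (spt a b t).

Definition cclosed K := forall p,
  (forall e : R, 0 < e -> exists2 w, K w & normc (w - p) <= e) -> K p.

Definition tri F (T : R[i] * R[i] * R[i]) : R[i] :=
  let: (a, b, c) := T in seg a b F + seg b c F + seg c a F.

Definition tri_in K (T : R[i] * R[i] * R[i]) :=
  let: (a, b, c) := T in [/\ K a, K b & K c].

Definition tri_diam_le (d : R) (T : R[i] * R[i] * R[i]) :=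
  let: (a, b, c) := T in
  [/\ normc (b - a) <= d, normc (c - b) <= d & normc (a - c) <= d].

(** The order of the vertices matters: the central triangle runs along each of its sides in the
    direction opposite to that of the neighbouring corner triangle, so the inner sides cancel. *)
Definition tri_parts (T : R[i] * R[i] * R[i]) :=
  let: (a, b, c) := T in
  let x := (a + b) / 2 in let y := (b + c) / 2 in let z := (c + a) / 2 in
  [:: (a, x, z); (x, b, y); (z, y, c); (x, y, z)].

(** The first part carrying at least a quarter of the integral in modulus. The default [T] would be
    returned if there were none, which [tri_stepP] excludes. *)
Definition tri_step F T :=
  nth T (tri_parts T) (find (fun S => normc (tri F T) <= 4 * normc (tri F S)) (tri_parts T)).

Lemma half_norm (x : R[i]) (d : R) : normc x <= d -> normc (x / 2) <= d / 2.
Proof.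
move=> h; rewrite normcM normcV.
have -> : normc (2 : R[i]) = 2.
  have -> : (2 : R[i]) = (2 : R)%:C by rewrite rmorph_nat.
  by rewrite normcR ger0_norm.
by rewrite ler_wpM2r // invr_ge0.
Qed.

Lemma spt_half a b : (a + b) / 2 = spt a b (2^-1).
Proof. by rewrite /spt fmorphV rmorph_nat; field. Qed.

Lemma convex_half K a b : cconvex K -> K a -> K b -> K ((a + b) / 2).
Proof. by move=> cK ka kb; rewrite spt_half; apply: cK => //; lra. Qed.

Lemma tri_parts_in K T : cconvex K -> tri_in K T ->
  forall S, S \in tri_parts T -> tri_in K S.
Proof.
move=> cK; case: T => [[a b] c] [ka kb kc] S.
have kx := convex_half cK ka kb; have ky := convex_half cK kb kc.
have kz := convex_half cK kc ka.
by rewrite !inE => /or4P[] /eqP ->.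
Qed.

(** The bound on the displacement of the first vertex makes the first vertices of the bisection
    sequence converge by [dyadic_limit]. *)
Lemma tri_parts_diam d T : tri_diam_le d T ->
  forall S, S \in tri_parts T ->
    tri_diam_le (d / 2) S /\ normc (S.1.1 - T.1.1) <= d / 2.
Proof.
case: T => [[a b] c] [h1 h2 h3] S.
have d0 : 0 <= d / 2 by have := le_trans (normc_ge0 _) h1; lra.
have k1 := half_norm h1; have k2 := half_norm h2; have k3 := half_norm h3.
have n1 : normc ((a - b) / 2) <= d / 2 by rewrite -normcN -mulNr opprB.
have n2 : normc ((b - c) / 2) <= d / 2 by rewrite -normcN -mulNr opprB.
have n3 : normc ((c - a) / 2) <= d / 2 by rewrite -normcN -mulNr opprB.
have E x y (h : normc y <= d / 2) : x = y -> normc x <= d / 2 by move=> ->.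
rewrite !inE => /or4P[] /eqP -> /=; split; try split;
  rewrite ?subrr ?normc0 //;
  solve [apply: (E _ _ k1); by field|apply: (E _ _ k2); by field|apply: (E _ _ k3); by field
        |apply: (E _ _ n1); by field|apply: (E _ _ n2); by field|apply: (E _ _ n3); by field].
Qed.

Lemma convex_segcont K F a b : cconvex K -> (forall w, K w -> ccont F w) ->
  K a -> K b -> segcont a b F.
Proof. by move=> cK cF ka kb t ht; apply: cF; exact: cK. Qed.

Lemma tri_partsE K F T : cconvex K -> (forall w, K w -> ccont F w) -> tri_in K T ->
  tri F T = \sum_(S <- tri_parts T) tri F S.
Proof.
move=> cK cF; case: T => [[a b] c] [ka kb kc].
have kx := convex_half cK ka kb; have ky := convex_half cK kb kc.
have kz := convex_half cK kc ka.
have sc := convex_segcont cK cF.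
rewrite /= !big_cons big_nil /tri (seg_mid (sc _ _ ka kb)) (seg_mid (sc _ _ kb kc)).
rewrite (seg_mid (sc _ _ kc ka)).
rewrite (seg_rev (sc _ _ kx kz)) (seg_rev (sc _ _ kx ky)) (seg_rev (sc _ _ ky kz)).
by ring.
Qed.

(** Pigeonhole: if all four parts fell short of a quarter, the triangle inequality would contradict
    [tri_partsE]. *)
Lemma tri_stepP K F T : cconvex K -> (forall w, K w -> ccont F w) -> tri_in K T ->
  tri_step F T \in tri_parts T /\ normc (tri F T) <= 4 * normc (tri F (tri_step F T)).
Proof.
move=> cK cF kT; rewrite /tri_step; set q := fun S => _.
have hq : has q (tri_parts T).
  apply/negPn/negP => nq.
  have sz : size (tri_parts T) = 4%N by move: {nq kT q} T => [[? ?] ?].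
  have := tri_partsE cK cF kT; move: sz nq.
  case: (tri_parts T) => [//|S1 [//|S2 [//|S3 [//|S4 [|//]]]]] _.
  rewrite /= orbF !negb_or => /and4P[]; rewrite /q -!ltNge => h1 h2 h3 h4.
  rewrite !big_cons big_nil addr0 => e.
  have := normcD (tri F S1) (tri F S2 + (tri F S3 + tri F S4)).
  have := normcD (tri F S2) (tri F S3 + tri F S4).
  have := normcD (tri F S3) (tri F S4).
  rewrite -e; lra.
by split; [rewrite mem_nth // -has_find|exact: nth_find hq].
Qed.

End Goursat.

Section GoursatTheorem.
Context {R : realType}.
Implicit Types (F G H : R[i] -> R[i]) (a b c z p : R[i]) (K : R[i] -> Prop).

Lemma sptE a b p (t : R) : spt a b t - p = (1 - t)%:C * (a - p) + t%:C * (b - p).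
Proof. by rewrite /spt rmorphB rmorph1; ring. Qed.

Lemma ball_convex p (r : R) : cconvex (fun w => normc (w - p) <= r).
Proof.
move=> a b t ha hb /andP[t0 t1]; rewrite sptE.
apply: le_trans (normcD _ _) _; rewrite !normcM !normcR !ger0_norm ?subr_ge0 //.
nra.
Qed.

Lemma ball_closed p (r : R) : cclosed (fun w => normc (w - p) <= r).
Proof.
move=> q H; apply/ler_addgt0Pr => e /H[w hw wq].
have -> : q - p = (w - p) - (w - q) by ring.
by apply: le_trans (normcB _ _) _; exact: lerD.
Qed.

(** An affine function has the explicit polynomial primitive [H], so the integral over a closed
    polygon telescopes. *)
Lemma tri_affine p q d T :
  tri (fun w : R[i] => q + d * (w - p)) T = 0.
Proof.
pose H w := q * w + d / 2 * ((w - p) * (w - p)).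
have D w : cder H w (q + d * (w - p)).
  have D1 : cder (fun w => w - p) w (1 - 0) by apply: cderB; [exact: cder_id|exact: cder_cst].
  apply: cder_eq (cderD (cderMl q (cder_id w)) (cderMl (d / 2) (cderM D1 D1))) _.
  by field.
have D' w : cder (fun w : R[i] => q + d * (w - p)) w (0 + d * (1 - 0)).
  apply: cderD; first exact: cder_cst.
  by apply: cderMl; apply: cderB; [exact: cder_id|exact: cder_cst].
have E a b : seg a b (fun w : R[i] => q + d * (w - p)) = H b - H a.
  by apply: seg_FTC => t _; [exact: cder_cont (D' _)|exact: D].
by case: T => [[a b] c]; rewrite /tri !E; ring.
Qed.

Lemma ccontD F G z : ccont F z -> ccont G z -> ccont (fun w => F w + G w) z.
Proof.
move=> c1 c2 e e0.
have e2 : 0 < e / 2 by lra.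
have [r r0 Hr] := c1 _ e2; have [q q0 Hq] := c2 _ e2.
exists (Num.min r q); first by rewrite lt_min r0.
move=> s; rewrite lt_min => /andP[h1 h2].
have -> : F s + G s - (F z + G z) = (F s - F z) + (G s - G z) by ring.
apply: le_trans (normcD _ _) _; have := Hr _ h1; have := Hq _ h2; lra.
Qed.

Lemma ccontMl c F z : ccont F z -> ccont (fun w => c * F w) z.
Proof.
move=> c1 e e0.
have c0 : 0 < 1 + normc c by rewrite ltr_wpDr ?normc_ge0.
have [r r0 Hr] := c1 (e / (1 + normc c)) (divr_gt0 e0 c0).
exists r => // s /Hr; rewrite ler_pdivlMr // -mulrBr normcM => H.
have := normc_ge0 (F s - F z); nra.
Qed.

(** The 6 is three sides times the factor 2 of [normc_seg]. *)
Lemma normc_tri K F T (M d : R) : cconvex K -> (forall w, K w -> ccont F w) ->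
  tri_in K T -> tri_diam_le d T -> (forall w, K w -> normc (F w) <= M) ->
  normc (tri F T) <= 6 * M * d.
Proof.
move=> cK cF; case: T => [[a b] c] [ka kb kc] [h1 h2 h3] hM.
have M0 : 0 <= M := le_trans (normc_ge0 _) (hM _ ka).
have B u v : K u -> K v -> normc (v - u) <= d -> normc (seg u v F) <= 2 * M * d.
  move=> ku kv huv; apply: le_trans (normc_seg (M := M) (convex_segcont cK cF ku kv) _) _.
    by move=> t ht; apply: hM; exact: cK.
  by rewrite ler_wpM2l // mulr_ge0.
have := B _ _ ka kb h1; have := B _ _ kb kc h2; have := B _ _ kc ka h3.
rewrite /tri; have := normcD (seg a b F + seg b c F) (seg c a F).
have := normcD (seg a b F) (seg b c F); lra.
Qed.

Theorem goursat K F a b c : cconvex K -> cclosed K ->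
  (forall w, K w -> exists d, cder F w d) -> K a -> K b -> K c ->
  seg a b F + seg b c F + seg c a F = 0.
Proof.
move=> cK clK dF ka kb kc.
have cF w : K w -> ccont F w by move=> /dF[d /cder_cont].
pose T0 := (a, b, c); pose T n := iter n (tri_step F) T0.
have T0in : tri_in K T0 by [].
have Tin n : tri_in K (T n).
  elim: n => // n IH; have [h _] := tri_stepP cK cF IH.
  exact: tri_parts_in cK IH _ h.
pose d := normc (b - a) + normc (c - b) + normc (a - c).
have d0 : 0 <= d by rewrite /d !addr_ge0 ?normc_ge0.
have e2 n : (2 : R) ^+ n != 0 by rewrite expf_neq0.
have dn0 n : 0 <= d / 2 ^+ n by rewrite divr_ge0 // exprn_ge0.
have dS n : d / 2 ^+ n / 2 = d / 2 ^+ n.+1 by rewrite exprS; field.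
have Td n : tri_diam_le (d / 2 ^+ n) (T n).
  elim: n => [|n IH].
    rewrite expr0 divr1 /d; have := normc_ge0 (b - a).
    by have := normc_ge0 (c - b); have := normc_ge0 (a - c); split; lra.
  have [h _] := tri_stepP cK cF (Tin n).
  by have [h' _] := tri_parts_diam IH h; rewrite -dS.
have TF n : normc (tri F T0) <= 4 ^+ n * normc (tri F (T n)).
  elim: n => [|n IH]; first by rewrite expr0 mul1r.
  apply: le_trans IH _; rewrite exprSr -mulrA ler_wpM2l ?exprn_ge0 //.
  by have [_ h] := tri_stepP cK cF (Tin n).
have [p hp] : exists p, forall n, normc ((T n).1.1 - p) <= 4 * d / 2 ^+ n.
  apply: dyadic_limit => n.
  have [h _] := tri_stepP cK cF (Tin n).
  have [_ h'] := tri_parts_diam (Td n) h.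
  by apply: le_trans h' _; have := dn0 n; lra.
have kp : K p.
  apply: clK => e e0; have [n hn] := ex_div_exp2_lt (4 * d) e0.
  exists (T n).1.1; last by apply: le_trans (hp n) _; exact: ltW.
  by have := Tin n; case: (T n) => [[? ?] ?] [].
have [q dq] := dF p kp.
(* After [n] bisections the remainder of [F] at [p] is at most [e * (5 * d / 2 ^+ n)] and the
   diameter at most [d / 2 ^+ n]; with the 6 of [normc_tri] this gives [30 * d ^+ 2 * e / 4 ^+ n],
   and the factor [4 ^+ n] from [TF] cancels. *)
apply: (@normc_le_eps_eq0 _ _ (30 * d ^+ 2)); first by rewrite mulr_ge0 ?sqr_ge0.
move=> e e0.
have /cderP /(_ e e0) [r r0 hr] := dq.
have [n hn] := ex_div_exp2_lt (5 * d) r0.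
have D5 : 5 * d / 2 ^+ n = 5 * (d / 2 ^+ n) by rewrite mulrA.
(* The 5 is 4 for the distance from [p] to the first vertex plus 1 for the diameter. *)
pose Kn w := K w /\ normc (w - p) <= 5 * d / 2 ^+ n.
have cKn : cconvex Kn.
  move=> u v t [u1 u2] [v1 v2] ht; split; first exact: cK.
  exact: (@ball_convex p (5 * d / 2 ^+ n) u v t).
have Tn : tri_in Kn (T n).
  have := Td n; have := Tin n; have := hp n.
  case: (T n) => [[u v] w] /= hu [ku kv kw] [h1 h2 h3].
  rewrite -mulrA in hu.
  have dn := dn0 n.
  split; split=> //; rewrite D5.
  - by lra.
  - have -> : v - p = (u - p) + (v - u) by ring.
    by apply: le_trans (normcD _ _) _; lra.
  - have -> : w - p = (u - p) - (u - w) by ring.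
    by apply: le_trans (normcB _ _) _; lra.
(* Subtracting the tangent [A] does not change the integral over the small triangle and leaves only
   the remainder of differentiability. *)
pose A w := F p + q * (w - p).
have cA w : ccont (fun w => - 1 * A w) w.
  apply: ccontMl; apply: cder_cont (cderD (cder_cst _ _) (cderMl q (cderB (cder_id _) (cder_cst _ _)))).
pose E w := F w + - 1 * A w.
have cE w : Kn w -> ccont E w by move=> [/cF kw _]; exact: ccontD.
have FE : tri F (T n) = tri E (T n).
  have S u v : Kn u -> Kn v -> seg u v E = seg u v F - seg u v A.
    move=> ku kv; rewrite segD ?segMl ?mulN1r //.
    - move=> t ht.
      exact: cder_cont (cderD (cder_cst _ _) (cderMl q (cderB (cder_id _) (cder_cst _ _)))).
    - by move=> t ht; apply: cF; have [] := cKn _ _ _ ku kv ht.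
  have := tri_affine p (F p) q (T n); move: Tn.
  case: (T n) => [[u v] w] [ku kv kw]; rewrite /tri -/A !S // => h.
  have -> : forall x y z x' y' z' : R[i],
    x - x' + (y - y') + (z - z') = x + y + z - (x' + y' + z') by move=> *; ring.
  by rewrite h subr0.
have := normc_tri (M := e * (5 * d / 2 ^+ n)) cKn cE Tn (Td n).
have hE w : Kn w -> normc (E w) <= e * (5 * d / 2 ^+ n).
  move=> [_ hw]; have := hr _ (le_lt_trans hw hn).
  have -> : F (p + (w - p)) - F p - q * (w - p) = E w by rewrite [p + _]addrC subrK /E /A; ring.
  by move=> h; apply: le_trans h _; rewrite ler_wpM2l // ltW.
move=> /(_ hE) h; apply: le_trans (TF n) _; rewrite FE.
have p4 : 0 <= (4 : R) ^+ n by rewrite exprn_ge0.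
apply: le_trans (ler_wpM2l p4 h) _.
have -> : (4 : R) ^+ n = 2 ^+ n * 2 ^+ n by rewrite -exprMn -natrM.
rewrite le_eqVlt; apply/predU1l; by field.
Qed.

End GoursatTheorem.

(** * Primitives of holomorphic functions on the disc *)

Section Primitive.
Context {R : realType}.
Implicit Types (F G H : R[i] -> R[i]) (a b c z p u v n w : R[i]) (K : R[i] -> Prop).

Lemma holo_discP F : holo_disc F <-> forall z, normc z < 1 -> exists d, cder F z d.
Proof.
split=> h z.
  move=> /discE /h dF; exists (cderiv F z); exact: derivableP.
by move=> /discE /h [d []].
Qed.

Lemma cint0_cder F z : holo_disc F -> normc z < 1 -> cder (cint0 F) z (F z).
Proof.
move=> /holo_discP hF z1.
(* Then [normc z = 1 - 2 * r], so the closed ball of radius [1 - r] lies in the disc and contains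
   [z + h] for all [h] of modulus below [r]. *)
pose r := (1 - normc z) / 2; have r0 : 0 < r by rewrite /r; lra.
pose K w := normc (w - 0) <= 1 - r.
have cK : cconvex K := @ball_convex R 0 (1 - r).
have clK : cclosed K := @ball_closed R 0 (1 - r).
have dF w : K w -> exists d, cder F w d.
  by rewrite /K subr0 => h; apply: hF; lra.
have cF w : K w -> ccont F w by move=> /dF[d /cder_cont].
have k0 : K 0 by rewrite /K subr0 normc0; have := normc_ge0 z; rewrite /r; lra.
have kz : K z by rewrite /K subr0 /r; lra.
have /cder_cont cz : cder F z (xget 0 [set d | cder F z d]).
  by have [d] := dF z kz; exact: xgetI.
apply/cderP => e e0.
have e2 : 0 < e / 2 by lra.
have [q q0 hq] := cz _ e2.
exists (Num.min q r); first by rewrite lt_min q0.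
move=> h; rewrite lt_min => /andP[h1 h2].
have kh : K (z + h).
  rewrite /K subr0; have := normcD z h; move: h2; rewrite /r; lra.
(* On the triangle 0, [z], [z + h] this turns the increment of [cint0 F] into the integral over the
   short segment from [z] to [z + h], where [F] is close to [F z]. *)
have := goursat cK clK dF k0 kz kh.
rewrite (seg_rev (convex_segcont cK cF k0 kh)) !cint0E => /eqP; rewrite subr_eq0 => /eqP <-.
rewrite [_ + _ - seg 0 z F]addrAC subrr add0r.
have sF := convex_segcont cK cF kz kh.
have sc a b c : segcont a b (fun=> c) by move=> t _; exact: cder_cont (cder_cst _ _).
have -> : F z * h = seg z (z + h) (fun=> F z).
  rewrite (@seg_FTC _ _ _ _ (fun w => F z * w)) //; first by ring.
  by move=> t _; apply: cder_eq (cderMl (F z) (cder_id _)) _; rewrite mulr1.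
rewrite -mulN1r -segMl // -segD //.
have -> : e * normc h = 2 * (e / 2) * normc (z + h - z).
  by rewrite [z + h]addrC addrK; field.
apply: normc_seg.
  move=> t ht; apply: ccontD; first exact: sF.
  by apply: ccontMl; exact: cder_cont (cder_cst _ _).
move=> t /andP[t0 t1]; rewrite mulN1r; apply: hq.
rewrite /spt [z + h]addrC addrK addrC addKr normcM normcR ger0_norm //.
have := normc_ge0 h; nra.
Qed.

End Primitive.

(** * Cauchy's formula on a diamond *)
Section DiamondSide.
Context {R : realType}.
Implicit Types (F G H : R[i] -> R[i]) (a b c z p u v n w : R[i]) (K : R[i] -> Prop).

(* A side [u, v] of the diamond with centre z0 and vertices z0 + r i^k; it lies on the
   line Re ((w - z0) n) = r. *)
Definition diamond_side z0 (r : R) n u v :=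
  [/\ normc n <= 2, complex.Re ((u - z0) * n) = r, complex.Re ((v - z0) * n) = r,
      normc (u - z0) <= r & normc (v - z0) <= r] /\ n * (v - u) = 2 * 'i * r%:C.

(** The radius [r / 4] is chosen against [normc n <= 2]: [z] then uses up at most half of the
    distance [r] from the centre to the side, measured along [n]. *)
Lemma side_dist z0 (r : R) n u v z : 0 < r -> diamond_side z0 r n u v ->
  normc (z - z0) < r / 4 ->
  r / 2 <= r - complex.Re ((z - z0) * n).
Proof.
move=> r0 [[n2 _ _ _ _] _] hz.
have := le_trans (ler_norm _) (normc_Re ((z - z0) * n)); rewrite normcM => h.
have := normc_ge0 (z - z0); nra.
Qed.

Lemma Re_spt n a b z (t : R) : complex.Re ((spt a b t - z) * n) =
  (1 - t) * complex.Re ((a - z) * n) + t * complex.Re ((b - z) * n).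
Proof.
rewrite sptE mulrDl -!mulrA RecD (RecM (1 - t)%:C) (RecM t%:C) /=.
by rewrite !mul0r !subr0.
Qed.

Lemma halfplane_convex n z (m : R) : cconvex (fun w => m <= complex.Re ((w - z) * n)).
Proof. by move=> a b t ha hb /andP[t0 t1]; rewrite Re_spt; nra. Qed.

Lemma halfplane_closed n z (m : R) : cclosed (fun w => m <= complex.Re ((w - z) * n)).
Proof.
move=> q H; apply/ler_addgt0Pr => e e0.
have c0 : 0 < 1 + normc n by rewrite ltr_wpDr ?normc_ge0.
have [w hw] := H _ (divr_gt0 e0 c0).
rewrite ler_pdivlMr // => wq; apply: le_trans hw _.
have -> : (w - z) * n = (q - z) * n + (w - q) * n by ring.
rewrite RecD lerD2l.
apply: le_trans (ler_norm _) _; apply: le_trans (normc_Re _) _.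
rewrite normcM; have := normc_ge0 (w - q); nra.
Qed.

(** The side and its image under the homothety of centre [z] and ratio [s] bound a trapezoid, cut by
    a diagonal into two triangles for [goursat]. The convex set is a ball intersected with the
    half-plane bounded by the line of the image side; [s > 0] keeps [z] out of it, so [G] may be
    singular at [z]. *)
Lemma side_homothety z0 (r : R) n u v z (s : R) G :
  0 < r -> diamond_side z0 r n u v -> normc (z - z0) < r / 4 -> 0 < s <= 1 ->
  (forall w, normc (w - z0) <= r -> w != z -> exists d, cder G w d) ->
  seg u v G = seg (spt z u s) (spt z v s) G + seg u (spt z u s) G - seg v (spt z v s) G.
Proof.
move=> r0 S hz /andP[s0 s1] dG.
have hm := side_dist r0 S hz.
move: S => [[n2 hu hv ur vr] _].
set m := r - _ in hm.
have m0 : 0 < m by lra.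
pose K w := normc (w - z0) <= r /\ s * m <= complex.Re ((w - z) * n).
have cK : cconvex K.
  move=> a b t [a1 a2] [b1 b2] ht; split.
    exact: (@ball_convex R z0 r a b t).
  exact: (@halfplane_convex n z (s * m) a b t).
have clK : cclosed K.
  move=> q h; split.
    by apply: (@ball_closed R z0 r) => e /h[w [w1 w2] w3]; exists w.
  by apply: (@halfplane_closed n z (s * m)) => e /h[w [w1 w2] w3]; exists w.
have sm : 0 < s * m by rewrite mulr_gt0.
have dF w : K w -> exists d, cder G w d.
  move=> [w1 w2]; apply: dG => //; apply/eqP => E.
  by move: w2; rewrite E subrr mul0r /= leNgt sm.
have cF w : K w -> ccont G w by move=> /dF[d /cder_cont].
have E w : complex.Re ((w - z) * n) = complex.Re ((w - z0) * n) - complex.Re ((z - z0) * n).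
  by rewrite -RecB; congr complex.Re; ring.
have hzr : normc (z - z0) <= r by lra.
have ku : K u by split=> //; rewrite E hu -/m; nra.
have kv : K v by split=> //; rewrite E hv -/m; nra.
have s01 : 0 <= s <= 1 by rewrite s1 ltW.
have kus : K (spt z u s).
  split; first exact: (@ball_convex R z0 r z u s).
  by rewrite Re_spt subrr mul0r /= mulr0 add0r E hu.
have kvs : K (spt z v s).
  split; first exact: (@ball_convex R z0 r z v s).
  by rewrite Re_spt subrr mul0r /= mulr0 add0r E hv.
have sc := convex_segcont cK cF.
have h1 := goursat cK clK dF ku kv kus.
have h2 := goursat cK clK dF kv kvs kus.
rewrite (seg_rev (sc _ _ ku kus)) in h1.
rewrite (seg_rev (sc _ _ kus kvs)) (seg_rev (sc _ _ kv kus)) in h2.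
have -> : seg (spt z u s) (spt z v s) G + seg u (spt z u s) G - seg v (spt z v s) G =
    seg u v G - (seg u v G + seg v (spt z u s) G - seg u (spt z u s) G) -
    (seg v (spt z v s) G - seg (spt z u s) (spt z v s) G - seg v (spt z u s) G) by ring.
by rewrite h1 h2 !subr0.
Qed.

End DiamondSide.

Section CauchyFormula.
Context {R : realType}.
Implicit Types (F G H : R[i] -> R[i]) (a b c z p u v n w : R[i]) (K : R[i] -> Prop).

(** All distances to [z] scale with [s], so the bounds for the side itself are the case [s = 1]. The
    lower bound on the modulus is half of the one on the real part, because [normc n <= 2]. *)
Lemma side_spt z0 (r : R) n u v z (s t : R) : 0 < r -> diamond_side z0 r n u v ->
  normc (z - z0) < r / 4 -> 0 < s -> 0 <= t <= 1 ->
  s * (r / 4) <= normc (spt (spt z u s) (spt z v s) t - z) <= s * (2 * r) /\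
  0 < s * (r / 2) <= complex.Re ((spt (spt z u s) (spt z v s) t - z) * n).
Proof.
move=> r0 S hz s0 ht; have hm := side_dist r0 S hz.
move: S => [[n2 hu hv ur vr] _].
have E w : complex.Re ((w - z) * n) = complex.Re ((w - z0) * n) - complex.Re ((z - z0) * n).
  by rewrite -RecB; congr complex.Re; ring.
have D w : spt z w s - z = s%:C * (w - z) by rewrite /spt addrC addKr.
have X : spt (spt z u s) (spt z v s) t - z = s%:C * (spt u v t - z).
  by rewrite sptE !D /spt rmorphB rmorph1; ring.
have Re1 : complex.Re ((spt (spt z u s) (spt z v s) t - z) * n) =
  s * (r - complex.Re ((z - z0) * n)).
  rewrite X -mulrA RecM /= mul0r subr0; congr (_ * _).
  by rewrite Re_spt E hu E hv; ring.
have lo : 0 < s * (r / 2) <= complex.Re ((spt (spt z u s) (spt z v s) t - z) * n).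
  by rewrite Re1 mulr_gt0 ?divr_gt0 //= ler_wpM2l // ltW.
split => //; apply/andP; split.
  have := le_trans (ler_norm _) (normc_Re ((spt (spt z u s) (spt z v s) t - z) * n)).
  rewrite normcM; have := normc_ge0 (spt (spt z u s) (spt z v s) t - z).
  have h4 : s * (r / 4) * 2 = s * (r / 2) by field.
  move: lo => /andP[_ lo] h1 h2; nra.
rewrite X normcM normcR gtr0_norm //; apply: ler_wpM2l; first exact: ltW.
have -> : spt u v t - z = (spt u v t - z0) - (z - z0) by ring.
apply: le_trans (normcB _ _) _.
by have := @ball_convex R z0 r u v t ur vr ht; lra.
Qed.

Definition loop z0 (r : R) G := 
  seg (z0 + r%:C) (z0 + 'i * r%:C) G + seg (z0 + 'i * r%:C) (z0 - r%:C) G +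
  seg (z0 - r%:C) (z0 - 'i * r%:C) G + seg (z0 - 'i * r%:C) (z0 + r%:C) G.

Lemma normc_i : normc ('i : R[i]) = 1.
Proof. by rewrite /= expr0n expr1n add0r sqrtr1. Qed.

Lemma diamond_sides z0 (r : R) : 0 < r ->
  [/\ exists n, diamond_side z0 r n (z0 + r%:C) (z0 + 'i * r%:C),
      exists n, diamond_side z0 r n (z0 + 'i * r%:C) (z0 - r%:C),
      exists n, diamond_side z0 r n (z0 - r%:C) (z0 - 'i * r%:C) &
      exists n, diamond_side z0 r n (z0 - 'i * r%:C) (z0 + r%:C)].
Proof.
move=> r0.
have A w : z0 + w - z0 = w by rewrite addrC addKr.
have N : normc ('i * r%:C) = r by rewrite normcM normc_i normcR mul1r gtr0_norm.
have N' : normc r%:C = r by rewrite normcR gtr0_norm.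
have n2 (x y : R) : `|x| = 1 -> `|y| = 1 -> normc (x +i* y) <= 2.
  by move=> h1 h2; apply: le_trans (normc_le_ReIm _) _; rewrite /= h1 h2.
pose ReImE := (@RecM R, @ImcM R, @RecD R, @ImcD R, @RecN R, @ImcN R).
by split; [exists (1 +i* (-1))|exists ((-1) +i* (-1))|exists ((-1) +i* 1)|exists (1 +i* 1)];
  (split; [split; rewrite ?A ?normcN ?N ?N' ?lexx //;
    [apply: n2; rewrite ?normrN ?normr1 // |rewrite !ReImE /=; ring|rewrite !ReImE /=; ring]
  | apply: complex_ext; rewrite !ReImE /=; ring]).
Qed.

(** The loop can be shrunk towards [z] without changing the integral. On the small loop the
    numerator is at most [e], the denominator at least [s * (r / 4)] and each side at most
    [s * (2 * r)] long, so [s] cancels: four sides of [16 * e] each, including the factor 2 of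
    [normc_seg]. *)
Lemma loop_eps z0 (r e : R) F z : 0 < r -> 0 < e -> normc (z - z0) < r / 4 ->
  (forall w, normc (w - z0) <= r -> exists d, cder F w d) ->
  normc (loop z0 r (fun w => (F w - F z) * (w - z)^-1)) <= 64 * e.
Proof.
move=> r0 e0 hz dF.
have [d /cder_cont cF] : exists d, cder F z d by apply: dF; lra.
have [q q0 hq] := cF e e0.
(* Every point of the shrunk diamond is within [s * (2 * r)] of [z], hence where [F] differs from
   [F z] by at most [e]. *)
have [s /andP[s0 s1] hs] : exists2 s : R, 0 < s <= 1 & s * (2 * r) < q.
  exists (Num.min 1 (q / (2 * r) / 2)).
    by rewrite lt_min ltr01 ge_min lexx /= !divr_gt0 // mulr_gt0.
  rewrite -ltr_pdivlMr ?mulr_gt0 // gt_min; apply/orP; right.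
  have : 0 < q / (2 * r) by rewrite divr_gt0 // mulr_gt0.
  lra.
have s01 : 0 < s <= 1 by rewrite s0 s1.
set E := fun w => _.
have dE w : normc (w - z0) <= r -> w != z -> exists d, cder E w d.
  move=> /dF [d' h] wz; have wz' : w - z != 0 by rewrite subr_eq0.
  by eexists; apply: cderM; [apply: cderB h (cder_cst _ _)
    |exact: (cderV (F := fun x => x - z) wz' (cderB (cder_id _) (cder_cst _ _)))].
have side n u v : diamond_side z0 r n u v ->
    normc (seg (spt z u s) (spt z v s) E) <= 16 * e.
  move=> S; have h t ht := side_spt r0 S hz s0 (t := t) ht.
  move: S => [[n2 hu hv ur vr] _].
  have hzr : normc (z - z0) <= r by lra.
  have s01' : 0 <= s <= 1 by rewrite s1 ltW.
  have L : normc (spt z v s - spt z u s) <= s * (2 * r).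
    have -> : spt z v s - spt z u s = s%:C * ((v - z0) - (u - z0)) by rewrite /spt; ring.
    rewrite normcM normcR gtr0_norm // ler_wpM2l ?(ltW s0) //.
    by apply: le_trans (normcB _ _) _; lra.
  have M0 : 0 < s * (r / 4) by rewrite mulr_gt0 // divr_gt0.
  apply: le_trans (normc_seg (M := e / (s * (r / 4))) _ _) _.
  - move=> t ht; have [/andP[h1 _] _] := h t ht.
    have [d' /cder_cont //] : exists d, cder E (spt (spt z u s) (spt z v s) t) d.
    apply: dE; last first.
      by apply/eqP => X; move: h1; rewrite X subrr normc0 leNgt M0.
    apply: (@ball_convex R z0 r) => //; exact: (@ball_convex R z0 r).
  - move=> t ht; have [/andP[h1 h2] _] := h t ht.
    have w0 : 0 < normc (spt (spt z u s) (spt z v s) t - z) by lra.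
    rewrite /E normcM normcV; apply: ler_pM; rewrite ?invr_ge0 ?normc_ge0 //.
      by apply: hq; apply: le_lt_trans h2 hs.
    by rewrite lef_pV2.
  - have -> : 16 * e = 2 * (e / (s * (r / 4))) * (s * (2 * r)).
      by field; rewrite !gt_eqF.
    by rewrite ler_wpM2l // mulr_ge0 // divr_ge0 // ltW.
have [[n1 S1] [n2 S2] [n3 S3] [n4 S4]] := diamond_sides z0 r0.
have hom n u v S := @side_homothety R z0 r n u v z s E r0 S hz s01 dE.
rewrite /loop (hom _ _ _ S1) (hom _ _ _ S2) (hom _ _ _ S3) (hom _ _ _ S4).
(* The [q]s are the integrals from the vertices to their images; adjacent sides share one with
   opposite signs. *)
have spokes (p1 p2 p3 p4 q1 q2 q3 q4 : R[i]) :
    (p1 + q1 - q2) + (p2 + q2 - q3) + (p3 + q3 - q4) + (p4 + q4 - q1) = p1 + p2 + p3 + p4.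
  by ring.
rewrite spokes.
have -> : 64 * e = 16 * e + 16 * e + 16 * e + 16 * e by ring.
apply: le_trans (normcD _ _) _; apply: lerD; last exact: side S4.
apply: le_trans (normcD _ _) _; apply: lerD; last exact: side S3.
by apply: le_trans (normcD _ _) _; apply: lerD; [exact: side S1|exact: side S2].
Qed.

Lemma cauchy_loop z0 (r : R) F z : 0 < r -> normc (z - z0) < r / 4 ->
  (forall w, normc (w - z0) <= r -> exists d, cder F w d) ->
  loop z0 r (fun w => F w * (w - z)^-1) = F z * loop z0 r (fun w => (w - z)^-1).
Proof.
move=> r0 hz dF.
have E0 : loop z0 r (fun w => (F w - F z) * (w - z)^-1) = 0.
  by apply: (@normc_le_eps_eq0 _ _ 64) => // e e0; exact: loop_eps.
have side n u v : diamond_side z0 r n u v ->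
    seg u v (fun w => (F w - F z) * (w - z)^-1) =
    seg u v (fun w => F w * (w - z)^-1) - F z * seg u v (fun w => (w - z)^-1).
  move=> S; have h t ht := side_spt r0 S hz ltr01 (t := t) ht.
  move: S => [[n2 hu hv ur vr] _].
  have dV t : 0 <= t <= 1 -> exists d, cder (fun w => (w - z)^-1) (spt u v t) d.
    move=> /h[/andP[h1 _] _]; eexists.
    apply: (cderV (F := fun x => x - z)); last exact: cderB (cder_id _) (cder_cst _ _).
    apply/eqP => X; move: h1.
    by rewrite !spt1 X normc0 mul1r leNgt divr_gt0.
  have cV : segcont u v (fun w => (w - z)^-1).
    by move=> t /dV[d /cder_cont].
  have cFV : segcont u v (fun w => F w * (w - z)^-1).
    move=> t ht; have [d hd] := dV t ht.
    have [d' hd'] : exists d, cder F (spt u v t) d by apply: dF; exact: (@ball_convex R z0 r).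
    exact: cder_cont (cderM hd' hd).
  rewrite -mulNr -segMl // -segD //.
    by apply: eq_seg => t _; rewrite mulrBl mulNr.
  by move=> t ht; apply: ccontMl; exact: cV.
have [[n1 S1] [n2 S2] [n3 S3] [n4 S4]] := diamond_sides z0 r0.
have sum4 (p1 p2 p3 p4 q1 q2 q3 q4 c : R[i]) :
    (p1 - c * q1) + (p2 - c * q2) + (p3 - c * q3) + (p4 - c * q4) =
    p1 + p2 + p3 + p4 - c * (q1 + q2 + q3 + q4) by ring.
move: E0; rewrite /loop (side _ _ _ S1) (side _ _ _ S2) (side _ _ _ S3) (side _ _ _ S4) sum4.
by move/eqP; rewrite subr_eq0 => /eqP.
Qed.

(** With [x = w - z] on a side, [n * (v - u) = 2 * 'i * r%:C] gives the integrand [2 i r / (x n)],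
    of imaginary part [2 r Re(x n) / |x n|^2]. Since [Re(x n)] is at least [r / 2] and [|x n|] at
    most [4 r], this is at least 1/16 on every side. *)
Lemma loop_inv_neq0 z0 (r : R) z : 0 < r -> normc (z - z0) < r / 4 ->
  loop z0 r (fun w => (w - z)^-1) != 0.
Proof.
move=> r0 hz.
have side n u v : diamond_side z0 r n u v ->
    1 / 16 <= complex.Im (seg u v (fun w => (w - z)^-1)).
  move=> S; have h t ht := side_spt r0 S hz ltr01 (t := t) ht.
  move: S => [[n2 hu hv ur vr] nuv].
  have nz t : 0 <= t <= 1 -> spt u v t - z != 0.
    move=> /h[/andP[h1 _] _]; apply/eqP => X; move: h1.
    by rewrite !spt1 X normc0 mul1r leNgt divr_gt0.
  have cV : pcont01 (fun t => (spt u v t - z)^-1).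
    apply: (@segcont_pcont _ u v (fun w => (w - z)^-1)) => t /nz ht.
    exact: cder_cont (cderV (F := fun x => x - z) ht (cderB (cder_id _) (cder_cst _ _))).
  rewrite /seg -cIMl //= -[leLHS]int01_cst; apply: le_int01.
  - by move=> t _; exact: cst_continuous.
  - by move=> t ht; apply: pcont_Im; apply: pcontMl; exact: cV.
  move=> t ht; have [/andP[_ h2] /andP[_ h3]] := h t ht.
  move: h2 h3; rewrite !spt1 !mul1r; have := nz t ht.
  move: (spt u v t - z) => x x0 h2 h3.
  have n0 : n != 0.
    by apply/eqP => X; move: h3; rewrite X mulr0 /= leNgt divr_gt0.
  have -> : (v - u) / x = 'i * (2 * r)%:C * (x * n)^-1.
    have -> : v - u = n^-1 * (n * (v - u)) by rewrite mulrA mulVf // mul1r.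
    by rewrite nuv rmorphM rmorph_nat; field; rewrite x0 n0.
  have : normc (x * n) <= 4 * r.
    by rewrite normcM; have := normc_ge0 x; have := normc_ge0 n; nra.
  move: h3; case: (x * n) => A B /= h3 h4.
  have q1 : A ^+ 2 + B ^+ 2 <= 16 * r ^+ 2.
    have : Num.sqrt (A ^+ 2 + B ^+ 2) ^+ 2 <= (4 * r) ^+ 2.
      by rewrite ler_sqr ?nnegrE ?sqrtr_ge0 // mulr_ge0 // ltW.
    rewrite sqr_sqrtr ?addr_ge0 ?sqr_ge0 //; lra.
  have A0 : 0 < A by apply: lt_le_trans h3; rewrite divr_gt0.
  have q0 : 0 < A ^+ 2 + B ^+ 2 by rewrite ltr_wpDr ?sqr_ge0 // exprn_gt0.
  rewrite ?(mul0r, mul1r, mulr0, add0r, addr0, subr0, sub0r).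
  rewrite oppr0 mul0r add0r mulrA ler_pdivlMr //.
  have : r * (r / 2) <= r * A by rewrite ler_wpM2l // ltW.
  by lra.
have [[n1 S1] [n2 S2] [n3 S3] [n4 S4]] := diamond_sides z0 r0.
have sum4 (p1 p2 p3 p4 : R) : 1 / 16 <= p1 -> 1 / 16 <= p2 -> 1 / 16 <= p3 -> 1 / 16 <= p4 ->
    p1 + p2 + p3 + p4 != 0 by move=> *; rewrite gt_eqF //; lra.
apply/eqP => /(congr1 (@complex.Im R)); rewrite /loop !ImcD; apply/eqP.
exact: sum4 (side _ _ _ S1) (side _ _ _ S2) (side _ _ _ S3) (side _ _ _ S4).
Qed.

End CauchyFormula.

(** * Differentiation under the integral and holomorphy of the derivative *)

Section HolomorphicDerivative.
Context {R : realType}.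
Implicit Types (F G H l : R[i] -> R[i]) (a b c z p u v n w : R[i]).

Lemma segcont_bounded u v F : segcont u v F ->
  exists2 M : R, 0 <= M & forall t : R, 0 <= t <= 1 -> normc (F (spt u v t)) <= M.
Proof.
move=> /segcont_pcont c.
have [t0 _ ht0] : exists2 c, c \in `[0%R, 1%R] &
    forall t, t \in `[0%R, 1%R] -> normc (F (spt u v t)) <= normc (F (spt u v c)).
  apply: (@EVT_max R (fun t => normc (F (spt u v t)))) => //.
  apply: continuous_in_subspaceT => t; rewrite inE /= in_itv /= => ht.
  apply/cvgrPdist_le => e e0; have [r r0 Hr] := c t ht e e0.
  exists r => //= s; rewrite /ball_ /= distrC => /Hr hs; apply: le_trans hs.
  rewrite ler_norml; apply/andP; split.
    rewrite lerNl opprB lerBlDr; apply: le_trans (normcD _ _).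
    by rewrite subrK.
  rewrite lerBlDr normcBC; apply: le_trans (normcD _ _).
  by rewrite subrK.
by exists (normc (F (spt u v t0))) => [|t ht]; [exact: normc_ge0|apply: ht0; rewrite in_itv].
Qed.

(** A remainder that is quadratic in [h], uniformly along the segment, stays quadratic after
    integration, which is all that differentiation under the integral needs. *)
Lemma seg_param_cder u v z (k : R[i] -> R[i] -> R[i]) l (C rho : R) :
  0 < rho -> 0 <= C ->
  (forall h, normc h < rho -> segcont u v (k (z + h))) -> segcont u v l ->
  (forall (t : R) h, 0 <= t <= 1 -> normc h < rho ->
    normc (k (z + h) (spt u v t) - k z (spt u v t) - l (spt u v t) * h) <= C * normc h ^+ 2) ->
  cder (fun x => seg u v (k x)) z (seg u v l).
Proof.
move=> rho0 C0 ck cl H; apply/cderP => e e0.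
pose B := 1 + 2 * C * normc (v - u).
have B0 : 0 < B by rewrite ltr_wpDr // mulr_ge0 ?normc_ge0 // mulr_ge0.
exists (Num.min rho (e / B)); first by rewrite lt_min rho0 divr_gt0.
move=> h; rewrite lt_min ltr_pdivlMr // => /andP[h1 h2].
have ckz : segcont u v (k z) by rewrite -[z]addr0; apply: ck; rewrite normc0.
have c1 : segcont u v (fun w => - 1 * k z w) by move=> t ht; apply: ccontMl; exact: ckz.
have c2 : segcont u v (fun w => - h * l w) by move=> t ht; apply: ccontMl; exact: cl.
have c3 : segcont u v (fun w => k (z + h) w + - 1 * k z w).
  by move=> t ht; apply: ccontD; [exact: ck|exact: c1].
have -> : seg u v (k (z + h)) - seg u v (k z) - seg u v l * h =
    seg u v (fun w => k (z + h) w + - 1 * k z w + - h * l w).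
  by rewrite segD // segD ?segMl //; [ring|exact: ck].
apply: le_trans (normc_seg (M := C * normc h ^+ 2) _ _) _.
- by move=> t ht; apply: ccontD; [exact: c3|exact: c2].
- move=> t ht; apply: le_trans (H t h ht h1).
  by rewrite le_eqVlt; apply/predU1l; congr normc; ring.
have := normc_ge0 h; have := normc_ge0 (v - u); move: h2; rewrite /B => h2 v0 h0.
have -> : 2 * (C * normc h ^+ 2) * normc (v - u) =
  (normc h * (2 * C * normc (v - u))) * normc h by ring.
by rewrite ler_wpM2r //; lra.
Qed.

(** With [y = 1 / (w - z)] and [Y = 1 / (w - z - h)] the remainders are exactly [Y y^2 h^2] and
    [Y y^2 (2 y + Y) h^2]. For [|h| < rho / 2] one has [|y| <= a] and [|Y| <= 2 a] with
    [a = 1 / rho], whence the constants [2 a^3] and [8 a^4]. *)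
Lemma cauchy_kernel_cder u v z F (rho : R) : 0 < rho -> segcont u v F ->
  (forall t : R, 0 <= t <= 1 -> rho <= normc (spt u v t - z)) ->
  cder (fun x => seg u v (fun w => F w * (w - x)^-1)) z
    (seg u v (fun w => F w * (w - z)^-1 ^+ 2)) /\
  cder (fun x => seg u v (fun w => F w * (w - x)^-1 ^+ 2)) z
    (seg u v (fun w => F w * (2 * (w - z)^-1 ^+ 3))).
Proof.
move=> rho0 cF hz; have [M M0 hM] := segcont_bounded cF.
pose a := rho^-1; have a0 : 0 < a by rewrite invr_gt0.
have far h t : 0 <= t <= 1 -> normc h < rho / 2 -> rho / 2 <= normc (spt u v t - (z + h)).
  move=> ht hh; have := hz t ht.
  have -> : spt u v t - z = (spt u v t - (z + h)) + h by ring.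
  have := normcD (spt u v t - (z + h)) h; lra.
have nz h t : 0 <= t <= 1 -> normc h < rho / 2 -> spt u v t - (z + h) != 0.
  by move=> ht hh; rewrite -normc_gt0; apply: lt_le_trans (far h t ht hh); rewrite divr_gt0.
have nz0 t : 0 <= t <= 1 -> spt u v t - z != 0.
  by move=> ht; rewrite -normc_gt0; apply: lt_le_trans (hz t ht).
have y0 t : 0 <= t <= 1 -> normc (spt u v t - z)^-1 <= a.
  move=> ht; rewrite normcV lef_pV2 ?posrE ?normc_gt0 ?nz0 //; exact: hz.
have yh h t : 0 <= t <= 1 -> normc h < rho / 2 -> normc (spt u v t - (z + h))^-1 <= 2 * a.
  move=> ht hh; rewrite normcV.
  have -> : 2 * a = (rho / 2)^-1 by rewrite /a; field; rewrite gt_eqF.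
  by rewrite lef_pV2 ?posrE ?normc_gt0 ?nz //; [exact: far|rewrite divr_gt0].
have cV x w : w - x != 0 -> exists d, cder (fun w => (w - x)^-1) w d.
  move=> hw; eexists.
  exact: (cderV (F := fun w => w - x) hw (cderB (cder_id _) (cder_cst _ _))).
have ccM G w : ccont F w -> (exists d, cder G w d) -> ccont (fun w => F w * G w) w.
  move=> c1 [d /cder_cont c2] e e0.
  (* The three terms of the increment of the product sum to at most [e1 * A], where [e1 <= 1] takes
     care of the product of both increments. *)
  pose A := 1 + normc (F w) + normc (G w).
  have n1 := normc_ge0 (F w); have n2 := normc_ge0 (G w).
  have A0 : 0 < A by rewrite /A; lra.
  pose e1 := Num.min 1 (e / (2 * A)).
  have e10 : 0 < e1 by rewrite lt_min ltr01 divr_gt0 // mulr_gt0.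
  have [r r0 hr] := c1 _ e10; have [q q0 hq] := c2 _ e10.
  exists (Num.min r q); first by rewrite lt_min r0.
  move=> x; rewrite lt_min => /andP[/hr h1 /hq h2].
  have -> : F x * G x - F w * G w = (F x - F w) * (G x - G w) +
    ((F x - F w) * G w + F w * (G x - G w)) by ring.
  have l1 : e1 <= 1 by rewrite ge_min lexx.
  have : e1 <= e / (2 * A) by rewrite ge_min lexx orbT.
  rewrite ler_pdivlMr ?mulr_gt0 // => l2.
  apply: le_trans (normcD _ _) _.
  have := normcD ((F x - F w) * G w) (F w * (G x - G w)); rewrite !normcM.
  move: h1 h2 (normc_ge0 (F x - F w)) (normc_ge0 (G x - G w)).
  move: (normc (F x - F w)) (normc (G x - G w)) => X Y h1 h2 X0 Y0.
  have : X * Y <= e1 by nra.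
  have : X * normc (G w) <= e1 * normc (G w) by rewrite ler_wpM2r.
  have : normc (F w) * Y <= normc (F w) * e1 by rewrite ler_wpM2l.
  move: l2; rewrite /A; nra.
split.
- apply: (@seg_param_cder u v z (fun x w => F w * (w - x)^-1) _ (M * (2 * a ^+ 3)) (rho / 2)).
  + by rewrite divr_gt0.
  + by rewrite mulr_ge0 // mulr_ge0 // exprn_ge0 // ltW.
  + by move=> h hh t ht; apply: ccM; [exact: cF|apply: cV; exact: nz].
  + move=> t ht; apply: ccM; first exact: cF.
    have [d hd] := cV _ _ (nz0 t ht); eexists; exact: (cderM hd hd).
  + move=> t h ht hh; have := nz h t ht hh; have := nz0 t ht.
    have := y0 t ht; have := yh h t ht hh; have := hM t ht.
    move: (spt u v t) => w m1 m2 m3 m4 m5.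
    have -> : F w * (w - (z + h))^-1 - F w * (w - z)^-1 - F w * (w - z)^-1 ^+ 2 * h =
      F w * ((w - (z + h))^-1 * ((w - z)^-1 * (w - z)^-1)) * (h * h).
      by field; rewrite m4 m5.
    rewrite !normcM -expr2 ler_wpM2r ?sqr_ge0 //.
    have -> : 2 * a ^+ 3 = (2 * a) * (a * a) by ring.
    by rewrite ler_pM ?mulr_ge0 ?normc_ge0 // ler_pM ?mulr_ge0 ?normc_ge0 // ler_pM ?normc_ge0.
- apply: (@seg_param_cder u v z (fun x w => F w * (w - x)^-1 ^+ 2) _ (M * (8 * a ^+ 4)) (rho / 2)).
  + by rewrite divr_gt0.
  + by rewrite mulr_ge0 // mulr_ge0 // exprn_ge0 // ltW.
  + move=> h hh t ht; apply: ccM; first exact: cF.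
    have [d hd] := cV _ _ (nz h t ht hh); eexists; exact: (cderM hd hd).
  + move=> t ht; apply: ccM; first exact: cF.
    have [d hd] := cV _ _ (nz0 t ht); eexists; apply: cderMl; exact: (cderM hd (cderM hd hd)).
  + move=> t h ht hh; have := nz h t ht hh; have := nz0 t ht.
    have := y0 t ht; have := yh h t ht hh; have := hM t ht.
    move: (spt u v t) => w m1 m2 m3 m4 m5.
    have -> : F w * (w - (z + h))^-1 ^+ 2 - F w * (w - z)^-1 ^+ 2 -
        F w * (2 * (w - z)^-1 ^+ 3) * h =
      F w * ((w - (z + h))^-1 * ((w - z)^-1 * (w - z)^-1) *
        ((w - z)^-1 + (w - z)^-1 + (w - (z + h))^-1)) * (h * h).
      by field; rewrite m4 m5.
    rewrite 3!normcM -expr2 ler_wpM2r ?sqr_ge0 //.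
    have -> : 8 * a ^+ 4 = ((2 * a) * (a * a)) * (a + a + 2 * a) by ring.
    rewrite ler_pM ?normc_ge0 // normcM ler_pM ?normc_ge0 //.
      by rewrite !normcM ler_pM ?mulr_ge0 ?normc_ge0 // ler_pM ?normc_ge0.
    apply: le_trans (normcD _ _) _; apply: lerD => //.
    by apply: le_trans (normcD _ _) _; exact: lerD.
Qed.

Lemma loop_kernel_cder z0 (r : R) F z : 0 < r -> normc (z - z0) < r / 4 ->
  (forall w, normc (w - z0) <= r -> exists d, cder F w d) ->
  cder (fun x => loop z0 r (fun w => F w * (w - x)^-1)) z
    (loop z0 r (fun w => F w * (w - z)^-1 ^+ 2)) /\
  cder (fun x => loop z0 r (fun w => F w * (w - x)^-1 ^+ 2)) z
    (loop z0 r (fun w => F w * (2 * (w - z)^-1 ^+ 3))).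
Proof.
move=> r0 hz dF.
have side n u v : diamond_side z0 r n u v -> 
  cder (fun x => seg u v (fun w => F w * (w - x)^-1)) z
    (seg u v (fun w => F w * (w - z)^-1 ^+ 2)) /\
  cder (fun x => seg u v (fun w => F w * (w - x)^-1 ^+ 2)) z
    (seg u v (fun w => F w * (2 * (w - z)^-1 ^+ 3))).
  move=> S; apply: (@cauchy_kernel_cder u v z F (r / 4)); first by rewrite divr_gt0.
  - move: S => [[_ _ _ ur vr] _] t ht.
    have [d /cder_cont //] : exists d, cder F (spt u v t) d.
    by apply: dF; exact: (@ball_convex R z0 r).
  - move=> t ht; have [/andP[+ _] _] := side_spt r0 S hz ltr01 ht.
    by rewrite !spt1 mul1r.
have [[n1 /side[S1 T1]] [n2 /side[S2 T2]] [n3 /side[S3 T3]] [n4 /side[S4 T4]]] :=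
  diamond_sides z0 r0.
split; first exact: (cderD (cderD (cderD S1 S2) S3) S4).
exact: (cderD (cderD (cderD T1 T2) T3) T4).
Qed.

Theorem holo_cderiv F : holo_disc F -> holo_disc (cderiv F).
Proof.
move=> hF; apply/holo_discP => z0 z01.
pose r := (1 - normc z0) / 2; have r0 : 0 < r by rewrite /r; lra.
have dF w : normc (w - z0) <= r -> exists d, cder F w d.
  move=> h; apply: (holo_discP F).1 => //.
  have -> : w = (w - z0) + z0 by ring.
  apply: le_lt_trans (normcD _ _) _; move: h; rewrite /r; lra.
have d1 w : normc (w - z0) <= r -> exists d, cder (fun _ : R[i] => 1 : R[i]) w d.
  by move=> _; exists 0; exact: cder_cst.
pose P0 G x := loop z0 r (fun w => G w * (w - x)^-1).
pose P1 G x := loop z0 r (fun w => G w * (w - x)^-1 ^+ 2).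
pose k0 := P0 (fun=> 1); pose k1 := P1 (fun=> 1).
have k0E x : k0 x = loop z0 r (fun w => (w - x)^-1).
  by congr loop; apply/funext => w; rewrite mul1r.
have k0nz x : normc (x - z0) < r / 4 -> k0 x != 0.
  by move=> hx; rewrite k0E; exact: loop_inv_neq0.
have FE x : normc (x - z0) < r / 4 -> P0 F x * (k0 x)^-1 = F x.
  by move=> hx; rewrite /P0 cauchy_loop // -k0E mulfK // k0nz.
(* The quotient rule for [F = P0 F / k0], where [P1 F] and [k1] are the derivatives of [P0 F] and
   [k0]. All ingredients of [D] are again differentiable at [z0]. *)
pose D x := P1 F x * (k0 x)^-1 + P0 F x * - (k1 x / k0 x ^+ 2).
have in_ball x : normc (x - z0) < r / 4 ->
    exists2 q : R, 0 < q & forall w, normc (w - x) < q -> normc (w - z0) < r / 4.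
  move=> hx; exists (r / 4 - normc (x - z0)); first by lra.
  move=> w hw; have -> : w - z0 = (w - x) + (x - z0) by ring.
  by apply: le_lt_trans (normcD _ _) _; lra.
have DE x : normc (x - z0) < r / 4 -> cder F x (D x).
  move=> hx; apply: (@cder_near _ (fun x => P0 F x * (k0 x)^-1)).
    by have [q q0 hq] := in_ball x hx; exists q => // w /hq /FE.
  apply: cderM; first by have [] := loop_kernel_cder r0 hx dF.
  apply: cderV; first exact: k0nz.
  by have [] := loop_kernel_cder r0 hx d1.
have hz0 : normc (z0 - z0) < r / 4 by rewrite subrr normc0 divr_gt0.
have [S1 S2] := loop_kernel_cder r0 hz0 dF.
have [T1 T2] := loop_kernel_cder r0 hz0 d1.
eexists; apply: (@cder_near _ D).
  exists (r / 4); first by rewrite divr_gt0.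
  by move=> w /DE[_ <-].
apply: cderD; apply: cderM; [exact: S2|apply: cderV T1; exact: k0nz|exact: S1|].
apply: cderN; apply: cderM; first exact: T2.
apply: (cderV (F := fun x => k0 x ^+ 2)); first by rewrite expf_neq0 // k0nz.
exact: (cderM T1 T1).
Qed.

End HolomorphicDerivative.

(** * The operators S_g, T_g and M_g *)
Section Operators.
Context {R : realType}.
Implicit Types (f h u v : R[i] -> R[i]) (z c : R[i]).

(** Functions are total on [R[i]], but nothing is known about them outside the disc, so operator
    identities can hold only up to this relation. *)
Definition eqD u v := forall z, normc z < 1 -> u z = v z.

Lemma eqD_sym u v : eqD u v -> eqD v u.
Proof. by move=> h z hz; rewrite h. Qed.

Lemma eqD_trans v u w : eqD u v -> eqD v w -> eqD u w.
Proof. by move=> h k z hz; rewrite h // k. Qed.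

Lemma cderivE f z c : cder f z c -> cderiv f z = c.
Proof. by case. Qed.

Lemma holo_cder f z : holo_disc f -> normc z < 1 -> cder f z (cderiv f z).
Proof. by move=> /holo_discP h /h[d hd]; rewrite (cderivE hd). Qed.

Lemma disc_open z : normc z < 1 ->
  exists2 r : R, 0 < r & forall w, normc (w - z) < r -> normc w < 1.
Proof.
move=> hz; exists (1 - normc z) => [|w hw]; first by lra.
have -> : w = (w - z) + z by ring.
by apply: le_lt_trans (normcD _ _) _; lra.
Qed.

Lemma eqD_cder u v z c : eqD u v -> normc z < 1 -> cder u z c -> cder v z c.
Proof.
move=> h hz; apply: cder_near; have [r r0 hr] := disc_open hz.
by exists r => // w /hr /h.
Qed.

Lemma eqD_holo u v : eqD u v -> holo_disc u -> holo_disc v.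
Proof.
move=> h /holo_discP hu; apply/holo_discP => z hz.
by have [d hd] := hu z hz; exists d; exact: eqD_cder hd.
Qed.

Lemma eqD_cderiv u v : holo_disc u -> eqD u v -> eqD (cderiv u) (cderiv v).
Proof. by move=> hu h z hz; apply/esym/cderivE/(eqD_cder h hz)/holo_cder. Qed.

(** The zero function is integrated from 0 to [z] with two primitives: the difference [u - v] and
    the constant 0. *)
Lemma eqD_prim u v : holo_disc u -> holo_disc v -> u 0 = v 0 ->
  eqD (cderiv u) (cderiv v) -> eqD u v.
Proof.
move=> hu hv e0 ed z hz.
have seg01 (t : R) : 0 <= t <= 1 -> normc (spt 0 z t) < 1.
  move=> /andP[t0 t1]; rewrite /spt add0r subr0 normcM normcR ger0_norm //.
  have := normc_ge0 z; nra.
have : seg 0 z (fun _ : R[i] => 0 : R[i]) = (u z - v z) - (u 0 - v 0).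
  apply: (seg_FTC (H := fun w => u w - v w)) => t ht.
    exact: cder_cont (cder_cst _ _).
  have h1 := seg01 t ht.
  apply: cder_eq (cderB (holo_cder hu h1) (holo_cder hv h1)) _.
  by rewrite ed // subrr.
rewrite (seg_FTC (H := fun=> 0)) ?subrr => [|t _|t _].
- by rewrite e0 subrr subr0 => /esym /eqP; rewrite subr_eq0 => /eqP.
- exact: cder_cont (cder_cst _ _).
- exact: cder_cst.
Qed.

Lemma holo_lin c u v : holo_disc u -> holo_disc v -> holo_disc (fun z => c * u z + v z).
Proof.
move=> hu hv; apply/holo_discP => z hz; eexists.
by apply: cderD; [apply: cderMl|]; exact: holo_cder.
Qed.

Lemma holoM u v : holo_disc u -> holo_disc v -> holo_disc (fun z => u z * v z).
Proof.
move=> hu hv; apply/holo_discP => z hz; eexists.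
by apply: cderM; exact: holo_cder.
Qed.

Lemma holo_cst c : holo_disc (fun=> c).
Proof. by apply/holo_discP => z _; exists 0; exact: cder_cst. Qed.

Lemma cderiv_lin c u v : holo_disc u -> holo_disc v ->
  eqD (cderiv (fun z => c * u z + v z)) (fun z => c * cderiv u z + cderiv v z).
Proof.
by move=> hu hv z hz; apply: cderivE; apply: cderD; [apply: cderMl|]; exact: holo_cder.
Qed.

Lemma cint0_0 u : cint0 u 0 = 0.
Proof. by rewrite /cint0 mul0r. Qed.

Lemma holo_cint0 u : holo_disc u -> holo_disc (cint0 u).
Proof. by move=> hu; apply/holo_discP => z hz; exists (u z); exact: cint0_cder. Qed.

Lemma cderiv_cint0 u : holo_disc u -> eqD (cderiv (cint0 u)) u.
Proof. by move=> hu z hz; apply: cderivE; exact: cint0_cder. Qed.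

Lemma eqD_cint0 u v : holo_disc u -> eqD u v -> eqD (cint0 u) (cint0 v).
Proof.
move=> hu e; have hv := eqD_holo e hu.
apply: eqD_prim; [exact: holo_cint0 hu|exact: holo_cint0 hv|by rewrite !cint0_0|].
by move=> z hz; rewrite (cderiv_cint0 hu hz) (cderiv_cint0 hv hz) e.
Qed.

Lemma cint0_lin c u v : holo_disc u -> holo_disc v ->
  eqD (cint0 (fun z => c * u z + v z)) (fun z => c * cint0 u z + cint0 v z).
Proof.
move=> hu hv; have hl := holo_lin (c := c) hu hv.
have hu' := holo_cint0 hu; have hv' := holo_cint0 hv.
apply: eqD_prim; [exact: holo_cint0 hl|exact: holo_lin hu' hv'|by rewrite !cint0_0 mulr0 addr0|].
move=> z hz; rewrite (cderiv_lin c hu' hv' hz) (cderiv_cint0 hl hz).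
by rewrite (cderiv_cint0 hu hz) (cderiv_cint0 hv hz).
Qed.

Context {g : R[i] -> R[i]} (hg : holo_disc g).

Let S := Sop g.
Let T := Top g.
Let M := Mop g.

Lemma holo_Tint f : holo_disc f -> holo_disc (fun z => f z * cderiv g z).
Proof. by move=> hf; exact: holoM hf (holo_cderiv hg). Qed.

Lemma holo_Sint f : holo_disc f -> holo_disc (fun z => cderiv f z * g z).
Proof. by move=> hf; exact: holoM (holo_cderiv hf) hg. Qed.

Lemma holoT f : holo_disc f -> holo_disc (T f).
Proof. by move=> hf; exact: holo_cint0 (holo_Tint hf). Qed.

Lemma holoS f : holo_disc f -> holo_disc (S f).
Proof. by move=> hf; exact: holo_cint0 (holo_Sint hf). Qed.

Lemma holoMop f : holo_disc f -> holo_disc (M f).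
Proof. by move=> hf; exact: holoM hg hf. Qed.

Lemma cderivT f : holo_disc f -> eqD (cderiv (T f)) (fun z => f z * cderiv g z).
Proof. by move=> hf; exact: cderiv_cint0 (holo_Tint hf). Qed.

Lemma cderivS f : holo_disc f -> eqD (cderiv (S f)) (fun z => cderiv f z * g z).
Proof. by move=> hf; exact: cderiv_cint0 (holo_Sint hf). Qed.

Lemma cderivM f : holo_disc f ->
  eqD (cderiv (M f)) (fun z => cderiv g z * f z + g z * cderiv f z).
Proof. by move=> hf z hz; apply: cderivE; exact: cderM (holo_cder hg hz) (holo_cder hf hz). Qed.

Lemma T0 f : T f 0 = 0. Proof. exact: cint0_0. Qed.
Lemma S0 f : S f 0 = 0. Proof. exact: cint0_0. Qed.

Lemma eqDT u v : holo_disc u -> eqD u v -> eqD (T u) (T v).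
Proof. by move=> hu e; apply: eqD_cint0 (holo_Tint hu) _ => z hz; rewrite e. Qed.

Lemma eqDS u v : holo_disc u -> eqD u v -> eqD (S u) (S v).
Proof.
move=> hu e; apply: eqD_cint0 (holo_Sint hu) _ => z hz.
by rewrite (eqD_cderiv hu e hz).
Qed.

Lemma eqDM u v : eqD u v -> eqD (M u) (M v).
Proof. by move=> e z hz; rewrite /M /Mop e. Qed.

Lemma T_lin c u v : holo_disc u -> holo_disc v ->
  eqD (T (fun z => c * u z + v z)) (fun z => c * T u z + T v z).
Proof.
move=> hu hv; apply: eqD_trans (cint0_lin _ (holo_Tint hu) (holo_Tint hv)).
apply: eqD_cint0 (holo_Tint (holo_lin hu hv)) _ => z hz.
by rewrite mulrDl mulrA.
Qed.

Lemma S_lin c u v : holo_disc u -> holo_disc v ->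
  eqD (S (fun z => c * u z + v z)) (fun z => c * S u z + S v z).
Proof.
move=> hu hv; apply: eqD_trans (cint0_lin _ (holo_Sint hu) (holo_Sint hv)).
apply: eqD_cint0 (holo_Sint (holo_lin hu hv)) _ => z hz.
by rewrite (cderiv_lin _ hu hv hz) mulrDl mulrA.
Qed.

Lemma SPi0 f : holo_disc f -> eqD (S f) (S (Pi0 f)).
Proof.
move=> hf; apply: eqD_cint0 (holo_Sint hf) _ => z hz.
have D : cder (Pi0 f) z (cderiv f z).
  by apply: cder_eq (cderB (holo_cder hf hz) (cder_cst _ _)) _; rewrite subr0.
by rewrite (cderivE D).
Qed.

Lemma ME f z : M f z = g z * f z. Proof. by []. Qed.

Definition is_prim u d := [/\ holo_disc u, u 0 = 0 & eqD (cderiv u) d].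

Lemma primS f : holo_disc f -> is_prim (S f) (fun z => cderiv f z * g z).
Proof. by move=> hf; split; [exact: holoS|exact: S0|exact: cderivS]. Qed.

Lemma primT f : holo_disc f -> is_prim (T f) (fun z => f z * cderiv g z).
Proof. by move=> hf; split; [exact: holoT|exact: T0|exact: cderivT]. Qed.

Lemma prim_lin c u v d e : is_prim u d -> is_prim v e ->
  is_prim (fun z => c * u z + v z) (fun z => c * d z + e z).
Proof.
move=> [hu u0 du] [hv v0 dv]; split; first exact: holo_lin.
  by rewrite u0 v0 mulr0 addr0.
by move=> z hz; apply: etrans (cderiv_lin c hu hv hz) _; rewrite du // dv.
Qed.

(** This reduces each operator identity to a ring identity between derivatives. *)
Lemma prim_uniq u v d e : is_prim u d -> is_prim v e -> eqD d e -> eqD u v.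
Proof.
move=> [hu u0 du] [hv v0 dv] de; apply: (eqD_prim hu hv); first by rewrite u0.
by move=> z hz; rewrite (du z hz) (dv z hz) (de z hz).
Qed.

Lemma SM f : holo_disc f -> eqD (S (M f)) (fun z => 1 * S (S f) z + S (T f) z).
Proof.
move=> hf; have hS := holoS hf; have hT := holoT hf; have hM := holoMop hf.
apply: (prim_uniq (primS hM) (prim_lin 1 (primS hS) (primS hT))) => z hz.
move: (cderivM hf hz) (cderivS hf hz) (cderivT hf hz).
generalize (cderiv (M f) z) (cderiv (S f) z) (cderiv (T f) z) => x y t -> -> ->.
generalize (cderiv f z) (cderiv g z) => f' g'; ring.
Qed.

Lemma TM f : holo_disc f -> eqD (T (M f)) (S (T f)).
Proof.
move=> hf; have hT := holoT hf; have hM := holoMop hf.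
apply: (prim_uniq (primT hM) (primS hT)) => z hz.
move: (cderivT hf hz) (ME f z).
generalize (cderiv (T f) z) (M f z) => x y -> ->.
by ring.
Qed.

Lemma M_ST f : holo_disc f -> f 0 = 0 -> eqD (M f) (fun z => 1 * S f z + T f z).
Proof.
move=> hf f0.
have hMf : is_prim (M f) (fun z => cderiv g z * f z + g z * cderiv f z).
  split; [exact: holoMop|by rewrite ME f0 mulr0|exact: cderivM].
apply: (prim_uniq hMf (prim_lin 1 (primS hf) (primT hf))) => z hz.
by generalize (cderiv f z) (cderiv g z) => f' g'; ring.
Qed.

(** The derivative of the left side is [(S f) g'], and [M_ST] replaces [S f] by [g f - T f]; this is
    where [f 0 = 0] enters. *)
Lemma TS f : holo_disc f -> f 0 = 0 ->
  eqD (T (S f)) (fun z => - 1 * T (T f) z + S (T f) z).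
Proof.
move=> hf f0; have hT := holoT hf; have hS := holoS hf.
apply: (prim_uniq (primT hS) (prim_lin (- 1) (primT hT) (primS hT))) => z hz.
move: (M_ST hf f0 hz) (ME f z) (cderivT hf hz).
generalize (cderiv (T f) z) (M f z) (S f z) (T f z) => x m s t -> e ->.
have -> : s = g z * f z - t by rewrite -e; ring.
by ring.
Qed.

Lemma holo_Pi0 f : holo_disc f -> holo_disc (Pi0 f).
Proof.
move=> hf; apply/holo_discP => z hz; eexists.
by apply: cderB (holo_cder hf hz) (cder_cst _ _).
Qed.

Lemma Pi0_0 f : Pi0 f 0 = 0. Proof. exact: subrr. Qed.

Lemma M_lin c u v : holo_disc u -> holo_disc v ->
  eqD (M (fun z => c * u z + v z)) (fun z => c * M u z + M v z).
Proof. by move=> hu hv z _; rewrite !ME; ring. Qed.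

End Operators.

(* The identities between S_g, T_g and M_g from which normal forms are computed; keeping the
   operators abstract prevents the unifier from unfolding integrals and derivatives. *)
Record gops (R : realType) := GOps {
  hol : (R[i] -> R[i]) -> Prop;
  oS : (R[i] -> R[i]) -> R[i] -> R[i];
  oT : (R[i] -> R[i]) -> R[i] -> R[i];
  oM : (R[i] -> R[i]) -> R[i] -> R[i];
  hol_lin : forall c u v, hol u -> hol v -> hol (fun z => c * u z + v z);
  hol_cst : forall c, hol (fun=> c);
  hol_eqD : forall u v, eqD u v -> hol u -> hol v;
  hol_Pi0 : forall u, hol u -> hol (Pi0 u);
  hol_S : forall u, hol u -> hol (oS u);
  hol_T : forall u, hol u -> hol (oT u);
  hol_M : forall u, hol u -> hol (oM u);
  oS_0 : forall u, oS u 0 = 0;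
  oT_0 : forall u, oT u 0 = 0;
  oS_eqD : forall u v, hol u -> eqD u v -> eqD (oS u) (oS v);
  oT_eqD : forall u v, hol u -> eqD u v -> eqD (oT u) (oT v);
  oM_eqD : forall u v, eqD u v -> eqD (oM u) (oM v);
  oS_lin : forall c u v, hol u -> hol v ->
    eqD (oS (fun z => c * u z + v z)) (fun z => c * oS u z + oS v z);
  oT_lin : forall c u v, hol u -> hol v ->
    eqD (oT (fun z => c * u z + v z)) (fun z => c * oT u z + oT v z);
  oM_lin : forall c u v, hol u -> hol v ->
    eqD (oM (fun z => c * u z + v z)) (fun z => c * oM u z + oM v z);
  oSM : forall u, hol u -> eqD (oS (oM u)) (fun z => 1 * oS (oS u) z + oS (oT u) z);
  oTM : forall u, hol u -> eqD (oT (oM u)) (oS (oT u));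
  oM_ST : forall u, hol u -> u 0 = 0 -> eqD (oM u) (fun z => 1 * oS u z + oT u z);
  oTS : forall u, hol u -> u 0 = 0 ->
    eqD (oT (oS u)) (fun z => - 1 * oT (oT u) z + oS (oT u) z);
  oSPi0 : forall u, hol u -> eqD (oS u) (oS (Pi0 u)) }.

Section Instance.
Context {R : realType} (g : R[i] -> R[i]) (hg : holo_disc g).

Definition gops_of : gops R :=
  @GOps R (@holo_disc R) (Sop g) (Top g) (Mop g) (@holo_lin R) (@holo_cst R) (@eqD_holo R)
    (@holo_Pi0 R) (@holoS R g hg) (@holoT R g hg) (@holoMop R g hg) (@S0 R g) (@T0 R g)
    (@eqDS R g hg) (@eqDT R g hg) (@eqDM R g) (@S_lin R g hg) (@T_lin R g hg) (@M_lin R g)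
    (@SM R g hg) (@TM R g hg) (@M_ST R g hg) (@TS R g hg) (@SPi0 R g hg).

End Instance.

(** * Normal forms of words *)
Section NormalForm.
Context {R : realType}.
Implicit Types (o : gops R) (f h u v : R[i] -> R[i]) (z : R[i]) (al be : nat -> int).

(* [normal_form o k n al v] is the sum of the al_j S_g^(k-j) T_g^(n+j) v for j <= k,
   evaluated by Horner's rule in S_g. *)
Fixpoint normal_form o (k n : nat) al v : R[i] -> R[i] :=
  if k is k'.+1 then
    fun z => (al k)%:~R * opow (oT o) (n + k) v z + oS o (normal_form o k' n al v) z
  else fun z => (al 0%N)%:~R * opow (oT o) n v z.

Lemma normal_formS o k n al v z : normal_form o k.+1 n al v z =
  (al k.+1)%:~R * opow (oT o) (n + k.+1) v z + oS o (normal_form o k n al v) z.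
Proof. by []. Qed.

Definition delta0 (j : nat) : int := (j == 0%N)%:Z.
(** A normal form of length [k] ignores [al] beyond [k]; these values must be cleared before the
    length grows. *)
Definition extend0 (k : nat) al (j : nat) : int := if (j <= k)%N then al j else 0.
Definition shift1 al (j : nat) : int := if j is j'.+1 then al j' else 0.

Lemma eq_normal_form o k n al be v : (forall j, (j <= k)%N -> al j = be j) ->
  normal_form o k n al v = normal_form o k n be v.
Proof.
elim: k => [|k IH] h /=; first by rewrite h.
by rewrite IH ?h // => j hj; apply: h; exact: leqW.
Qed.

Lemma S_normal_form o k n al v :
  oS o (normal_form o k n al v) = normal_form o k.+1 n (extend0 k al) v.
Proof.
apply/funext => z /=; rewrite {1}/extend0 ltnn mul0r add0r.
by congr (oS o _ z); apply: eq_normal_form => j hj; rewrite /extend0 hj.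
Qed.

Lemma normal_form_delta0 o k n v :
  normal_form o k n delta0 v = opow (oS o) k (opow (oT o) n v).
Proof.
elim: k => [|k IH]; apply/funext => z /=; first by rewrite mul1r.
by rewrite mul0r add0r IH.
Qed.

Definition letter_ops o (a : letter) := match a with LM => oM o | LS => oS o | LT => oT o end.

Definition word_ops o (w : seq letter) := foldr (fun a acc => letter_ops o a \o acc) id w.

Section Holomorphic.
Context {o : gops R}.

Lemma holo_opowT n v : hol o v -> hol o (opow (oT o) n v).
Proof. by move=> hv; elim: n => //= n IH; exact: hol_T. Qed.

Lemma holo_opowS n v : hol o v -> hol o (opow (oS o) n v).
Proof. by move=> hv; elim: n => //= n IH; exact: hol_S. Qed.

Lemma holo_scale (c : R[i]) v : hol o v -> hol o (fun z => c * v z).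
Proof.
move=> hv; apply: hol_eqD (hol_lin c hv (hol_cst o 0)) => z _.
exact: addr0.
Qed.

Lemma holo_normal_form k n al v : hol o v -> hol o (normal_form o k n al v).
Proof.
move=> hv; elim: k => [|k IH] /=; first exact/holo_scale/holo_opowT.
by apply: hol_lin; [exact: holo_opowT|exact: hol_S].
Qed.

Lemma T_scale (c : R[i]) u : hol o u -> eqD (oT o (fun z => c * u z)) (fun z => c * oT o u z).
Proof.
move=> hu; have h0 := hol_cst o 0.
have e : eqD (fun z => c * u z) (fun z => c * u z + (fun=> 0) z) by move=> z _; rewrite addr0.
apply: eqD_trans (oT_eqD (holo_scale c hu) e) _.
apply: eqD_trans (oT_lin c hu h0) _ => z hz.
have -> : oT o (fun=> 0) z = 0; last by rewrite addr0.
(* Linearity is available only in the shape [c * u + v]; with [c = -1] and [u = v = 0] it yields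
   that the image of 0 is 0. *)
have -> : oT o (fun=> 0) = oT o (fun z => -1 * (fun=> 0) z + (fun=> 0) z).
  by congr (oT o _); apply/funext => x; rewrite mulr0 addr0.
by rewrite (oT_lin _ h0 h0) // mulN1r addNr.
Qed.

Lemma S_scale (c : R[i]) u : hol o u -> eqD (oS o (fun z => c * u z)) (fun z => c * oS o u z).
Proof.
move=> hu; have h0 := hol_cst o 0.
have e : eqD (fun z => c * u z) (fun z => c * u z + (fun=> 0) z) by move=> z _; rewrite addr0.
apply: eqD_trans (oS_eqD (holo_scale c hu) e) _.
apply: eqD_trans (oS_lin c hu h0) _ => z hz.
have -> : oS o (fun=> 0) z = 0; last by rewrite addr0.
have -> : oS o (fun=> 0) = oS o (fun z => -1 * (fun=> 0) z + (fun=> 0) z).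
  by congr (oS o _); apply/funext => x; rewrite mulr0 addr0.
by rewrite (oS_lin _ h0 h0) // mulN1r addNr.
Qed.

(** Reindexing: the term [j + 1] of the pair [k + 1], [n] and the term [j] of the pair [k], [n + 1]
    are the same product. *)
Lemma normal_form_shift k n al v : hol o v ->
  eqD (normal_form o k.+1 n (shift1 al) v) (normal_form o k n.+1 al v).
Proof.
move=> hv; elim: k => [|k IH] z hz.
  rewrite /= addn1 S_scale //; last exact: holo_opowT.
  by rewrite mul0r addr0.
rewrite (normal_formS o k.+1) (normal_formS o k n.+1) addSnnS; congr (_ + _).
by apply: oS_eqD hz; [exact: holo_normal_form|exact: IH].
Qed.

Lemma normal_form_lin k n (c : int) al be v : hol o v ->
  eqD (normal_form o k n (fun j => c * al j + be j) v)
    (fun z => c%:~R * normal_form o k n al v z + normal_form o k n be v z).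
Proof.
move=> hv; elim: k => [|k IH] z hz /=; first by rewrite rmorphD rmorphM; ring.
have ha := holo_normal_form k n al hv.
have hb := holo_normal_form k n be hv.
have hl := holo_normal_form k n (fun j => c * al j + be j) hv.
by rewrite (oS_eqD hl IH) // (oS_lin ) // rmorphD rmorphM; ring.
Qed.

(** Every term with an [S] or a [T] vanishes at 0, so only [al 0 * v], for [k = n = 0], can cause
    trouble; each alternative disposes of it. *)
Lemma normal_form_0 k n al v : (0 < n)%N \/ v 0 = 0 \/ al 0%N = 0 ->
  normal_form o k n al v 0 = 0.
Proof.
have P m : (0 < m)%N -> opow (oT o) m v 0 = 0 by case: m => // m _; exact: oT_0.
case: k => [|k] /= c; last by rewrite (P (n + k.+1)%N) ?addnS // mulr0 add0r oS_0.
move: c => [n0|[v0|->]]; last by rewrite mul0r.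
  by rewrite P // mulr0.
by case: n => [|n] /=; rewrite ?v0 ?oT_0 mulr0.
Qed.

End Holomorphic.

(** With [u] the form of length [k], [T S u = S T u - T T u]. Induction rewrites [T u] with
    coefficients [b1] and then [T T u] with [b2], which is why it runs over all [al] and [n]. The
    second contribution is shifted by one and leaves the leading coefficient alone. *)
Lemma T_normal_form k al : exists2 be, be 0%N = al 0%N &
  forall o n v, hol o v -> (0 < n)%N \/ v 0 = 0 \/ al 0%N = 0 ->
    eqD (oT o (normal_form o k n al v)) (normal_form o k n.+1 be v).
Proof.
elim: k al => [|k IH] al.
  by exists al => // o n v hv _; apply: T_scale => //; exact: holo_opowT.
have [b1 b10 h1] := IH al; have [b2 b20 h2] := IH b1.
(* The top entry belongs to the pure power of [T], to which [T] just adds one more factor. *)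
pose ga j := if (j <= k)%N then b1 j else al k.+1.
exists (fun j => -1 * shift1 b2 j + ga j); first by rewrite mulr0 add0r.
move=> o n v hv c.
pose u := normal_form o k n al v.
have hu : hol o u := holo_normal_form k n al hv.
have u0 : u 0 = 0 := normal_form_0 k c.
have hT := holo_opowT (n + k.+1) hv.
have e1 := h1 o n v hv c.
have e2 := h2 o n.+1 v hv (or_introl isT).
have hTu := hol_T hu.
have eTT : eqD (oT o (oT o u)) (normal_form o k.+1 n.+1 (shift1 b2) v).
  apply: eqD_trans (oT_eqD hTu e1) _; apply: eqD_trans e2 _.
  exact/eqD_sym/normal_form_shift.
move=> z hz; rewrite (normal_form_lin ) // [LHS](oT_lin ) //; last exact: hol_S.
rewrite (oTS hu u0) // eTT // (oS_eqD hTu e1) // rmorphN rmorph1.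
have -> : normal_form o k.+1 n.+1 ga v z = (al k.+1)%:~R * opow (oT o) (n + k.+1).+1 v z +
    oS o (normal_form o k n.+1 b1 v) z.
  rewrite normal_formS {1}/ga ltnn addSn; congr (_ + oS o _ z).
  by apply: eq_normal_form => j hj; rewrite /ga hj.
by rewrite /opow iterS; ring.
Qed.

Lemma M_normal_form k al : exists2 be, be 0%N = al 0%N &
  forall o n v, hol o v -> (0 < n)%N \/ v 0 = 0 \/ al 0%N = 0 ->
    eqD (oM o (normal_form o k n al v)) (normal_form o k.+1 n be v).
Proof.
have [b b0 hb] := T_normal_form k al.
exists (fun j => 1 * extend0 k al j + shift1 b j); first by rewrite mul1r addr0.
move=> o n v hv c z hz.
have hu := holo_normal_form k n al hv.
rewrite (oM_ST hu (normal_form_0 k c)) // hb // (normal_form_lin ) //.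
by rewrite (normal_form_shift ) // -S_normal_form.
Qed.

Lemma letter_normal_form (a : letter) k al : exists2 be, be 0%N = al 0%N &
  forall o n v, hol o v -> (0 < n)%N \/ v 0 = 0 \/ al 0%N = 0 ->
    eqD (letter_ops o a (normal_form o k n al v))
        (normal_form o ((a != LT) + k) ((a == LT) + n) be v).
Proof.
case: a => /=; [exact: M_normal_form| |exact: T_normal_form].
exists (extend0 k al) => // o n v hv _ z hz.
by rewrite S_normal_form.
Qed.

Lemma holo_letter o a u : hol o u -> hol o (letter_ops o a u).
Proof. by case: a => hu; [exact: hol_M|exact: hol_S|exact: hol_T]. Qed.

Lemma holo_word o w u : hol o u -> hol o (word_ops o w u).
Proof. by move=> hu; elim: w => //= a w IH; exact: holo_letter. Qed.

Lemma eqD_letter o a u v : hol o u -> eqD u v ->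
  eqD (letter_ops o a u) (letter_ops o a v).
Proof. by case: a => hu; [exact: oM_eqD|exact: oS_eqD|exact: oT_eqD]. Qed.

Lemma letter_lin o a (c : R[i]) u v : hol o u -> hol o v ->
  eqD (letter_ops o a (fun z => c * u z + v z)) (fun z => c * letter_ops o a u z + letter_ops o a v z).
Proof.
by case: a => hu hv; [exact: oM_lin|exact: oS_lin|exact: oT_lin].
Qed.

(** The clause [(0 < n)%N \/ al 0%N = 0] is the invariant under which the sum in [f] vanishes at 0,
    so that a further [M] or [T] can be applied to it. *)
Definition has_normal_form (d : nat) (w : seq letter) (k n : nat) :=
  exists al be, [/\ al 0%N = 1 - d%:Z, be 0%N = d%:Z, (0 < n)%N \/ al 0%N = 0 &
    forall o f, hol o f ->
      eqD (word_ops o w f)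
        (fun z => 1 * normal_form o k n al f z + normal_form o k n be (Pi0 f) z)].

Lemma normal_form_cons d a w k n : has_normal_form d w k n ->
  has_normal_form d (a :: w) ((a != LT) + k) ((a == LT) + n).
Proof.
move=> [al [be [a0 b0 c h]]].
have [al' a0' ha] := letter_normal_form a k al.
have [be' b0' hb] := letter_normal_form a k be.
exists al', be'; split; rewrite ?a0' ?b0' //.
  by case: c => [n0|]; [left; rewrite addn_gt0 n0 orbT|right].
move=> o f hf; have hw := holo_word w hf.
have hP := hol_Pi0 hf.
have h1 := holo_normal_form k n al hf; have h2 := holo_normal_form k n be hP.
apply: eqD_trans (eqD_letter a hw (h o f hf)) _.
apply: eqD_trans (letter_lin a 1 h1 h2) _ => z hz.
rewrite ha //; last by case: c => [|->]; [left|right; right].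
by rewrite hb //; right; left; exact: Pi0_0.
Qed.

Lemma TM_word o i f : hol o f ->
  eqD (word_ops o (LT :: nseq i LM) f) (opow (oS o) i (oT o f)).
Proof.
move=> hf; elim: i => [|i IH] //=.
have hw := holo_word (nseq i LM) hf.
apply: eqD_trans (oTM hw) _.
by apply: (oS_eqD _ IH); exact: hol_T.
Qed.

Lemma normal_form_TM i : has_normal_form 0 (LT :: nseq i LM) i 1.
Proof.
exists delta0, (fun=> 0); split => //; first by left.
move=> o f hf; apply: eqD_trans (TM_word i hf) _ => z hz.
rewrite normal_form_delta0 mul1r.
have hP := hol_Pi0 hf.
(* Zero coefficients satisfy [0 = -1 * 0 + 0], so by linearity their normal form is 0. *)
have := normal_form_lin i 1 (-1) (fun=> 0) (fun=> 0) hP hz.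
rewrite (@eq_normal_form _ _ _ _ (fun=> 0)); last by move=> j _; rewrite mulr0 addr0.
by rewrite rmorphN rmorph1 mulN1r addNr => ->; rewrite addr0.
Qed.

(** One more [M] gives [S M (M^i f) = S (S M^i f) + S (T M^i f)]: the first term extends the
    induction hypothesis by an [S], the second is [S^(i+1) T f] and adds 1 to the coefficient of
    index 1. For [i = 0] the constant is dropped by passing to [Pi0 f]. *)
Lemma normal_form_SM i : has_normal_form 1 (LS :: nseq i LM) i.+1 0.
Proof.
elim: i => [|i [al [be [a0 b0 c h]]]].
  exists (fun=> 0), delta0; split => //; first by right.
  move=> o f hf; apply: eqD_trans (oSPi0 hf) _ => z hz.
  rewrite normal_form_delta0 mul1r.
  have := normal_form_lin 1 0 (-1) (fun=> 0) (fun=> 0) hf hz.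
  rewrite (@eq_normal_form _ _ _ _ (fun=> 0)); last by move=> j _; rewrite mulr0 addr0.
  by rewrite rmorphN rmorph1 mulN1r addNr => ->; rewrite add0r.
exists (fun j => 1 * extend0 i.+1 al j + shift1 delta0 j), (extend0 i.+1 be).
have A0 : al 0%N = 0 by rewrite a0.
have A0' : 1 * extend0 i.+1 al 0 + shift1 delta0 0 = 0 by rewrite mul1r addr0 /extend0 /= A0.
split; [by rewrite A0'|by rewrite /extend0 /= b0|by right|].
move=> o f hf.
have hw := holo_word (nseq i LM) hf.
apply: eqD_trans (oSM hw) _ => z hz.
have hP := hol_Pi0 hf.
have hS := hol_S hw; have hT := hol_T hw.
have h1 := holo_normal_form i.+1 0 al hf; have h2 := holo_normal_form i.+1 0 be hP.
rewrite (oS_eqD hS (h o f hf)) // (oS_lin ) // (oS_eqD hT (TM_word i hf)) //.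
rewrite (normal_form_lin ) // (normal_form_shift ) // -!S_normal_form.
by rewrite normal_form_delta0 /opow iterS /=; ring.
Qed.

Lemma normal_form_sum o k n al v z : hol o v -> normc z < 1 ->
  normal_form o k n al v z =
  \sum_(0 <= j < k.+1) (al j)%:~R * opow (oS o) (k - j) (opow (oT o) (n + j) v) z.
Proof.
move=> hv; elim: k z => [|k IH] z hz; first by rewrite big_nat1 addn0.
rewrite big_nat_recr //= subnn addrC; congr (_ + _).
have hS j : hol o (opow (oS o) (k - j) (opow (oT o) (n + j) v)).
  exact/holo_opowS/holo_opowT.
have hsum m : hol o (fun x => \sum_(0 <= j < m)
    (al j)%:~R * opow (oS o) (k - j) (opow (oT o) (n + j) v) x) /\
  eqD (oS o (fun x => \sum_(0 <= j < m)
    (al j)%:~R * opow (oS o) (k - j) (opow (oT o) (n + j) v) x))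
   (fun x => \sum_(0 <= j < m)
    (al j)%:~R * oS o (opow (oS o) (k - j) (opow (oT o) (n + j) v)) x).
  (* The induction runs over the number of summands with [k] fixed, carrying holomorphy along
     because linearity of [S] requires it. *)
  elim: m => [|m [H1 H2]].
    have -> : (fun x => \sum_(0 <= j < 0)
        (al j)%:~R * opow (oS o) (k - j) (opow (oT o) (n + j) v) x) = (fun=> 0).
      by apply/funext => x; rewrite big_nil.
    split; first exact: hol_cst.
    move=> x hx; rewrite big_nil.
    have := S_scale 0 (hol_cst o 0) hx.
    by rewrite /= !mul0r.
  have -> : (fun x => \sum_(0 <= j < m.+1)
        (al j)%:~R * opow (oS o) (k - j) (opow (oT o) (n + j) v) x) =
    (fun x => (al m)%:~R * opow (oS o) (k - m) (opow (oT o) (n + m) v) x +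
      (\sum_(0 <= j < m) (al j)%:~R * opow (oS o) (k - j) (opow (oT o) (n + j) v) x)).
    by apply/funext => x; rewrite big_nat_recr //= addrC.
  split; first exact: hol_lin.
  move=> x hx; rewrite (oS_lin ) // H2 // big_nat_recr //=; exact: addrC.
have hN := holo_normal_form k n al hv.
rewrite (oS_eqD hN IH) // (hsum k.+1).2 //.
by rewrite !big_nat; apply: eq_bigr => j /andP[_ hj]; rewrite subSn.
Qed.

End NormalForm.

(** * From words to the theorem *)

Lemma word_normal_form (R : realType) d (w' w : seq letter) k n :
  @has_normal_form R d w k n ->
  @has_normal_form R d (w' ++ w) (count (predC1 LT) w' + k) (count (pred1 LT) w' + n).
Proof.
by move=> h; elim: w' => //= a w' IH; rewrite -!addnA; exact: normal_form_cons.
Qed.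

Lemma ends_in_nonM (w : seq letter) : (0 < count (predC1 LM) w)%N ->
  ends_in w LS \/ ends_in w LT.
Proof.
have E i : nseq i LM ++ [:: LM] = nseq i.+1 LM by rewrite -addn1 nseqD.
elim/last_ind: w => // w a IH; rewrite -cats1 count_cat /= addn0.
case: a => /= h.
- have [] := IH; first by move: h; rewrite addn0.
  + by move=> [w' [i ->]]; left; exists w', i.+1; rewrite -catA cat_cons E.
  + by move=> [w' [i ->]]; right; exists w', i.+1; rewrite -catA cat_cons E.
- by left; exists w, 0%N.
- by right; exists w, 0%N.
Qed.

(** The right-hand letter is thus a function of the word, so a word cannot end in both ways; this
    settles [delta_word] in the [T] case. *)
Lemma ends_in_last w a : a != LM -> ends_in w a -> last LM [seq x <- w | x != LM] = a.
Proof.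
move=> aM [w' [i ->]]; rewrite filter_cat /= aM last_cat /=.
by elim: i.
Qed.

Lemma count_nonT (w : seq letter) :
  count (predC1 LT) w = (count (pred1 LM) w + count (pred1 LS) w)%N.
Proof. by elim: w => //= a w ->; case: a; rewrite /= ?add0n ?add1n ?addnS. Qed.

Lemma count_nonM (w : seq letter) :
  count (predC1 LM) w = (count (pred1 LS) w + count (pred1 LT) w)%N.
Proof. by elim: w => //= a w ->; case: a; rewrite /= ?add0n ?add1n ?addnS. Qed.

Lemma word_has_normal_form (R : realType) (w : seq letter) : (0 < count (predC1 LM) w)%N ->
  @has_normal_form R (delta_word w) w (count (predC1 LT) w) (count (pred1 LT) w).
Proof.
move=> /ends_in_nonM[] E.
- have -> : delta_word w = 1%N by rewrite /delta_word asboolT.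
  case: E => [w' [i ->]].
  have := word_normal_form w' (@normal_form_SM R i).
  by rewrite !count_cat /= !count_nseq /= mul1n mul0n.
- have -> : delta_word w = 0%N.
    rewrite /delta_word asboolF // => E'.
    by have := @ends_in_last w LT isT E; rewrite (@ends_in_last w LS isT E').
  case: E => [w' [i ->]].
  have := word_normal_form w' (@normal_form_TM R i).
  by rewrite !count_cat /= !count_nseq /= mul1n mul0n.
Qed.

Unset Implicit Arguments.

Theorem theorem3p1 (R : realType) (l m n : nat) (w : seq letter) :
  count (pred1 LM) w = l -> count (pred1 LS) w = m -> count (pred1 LT) w = n ->
  (1 <= m + n)%N -> (1 <= l + m)%N ->
  (exists a b : nat -> int,
    forall g : R[i] -> R[i], holo_disc g ->
    forall f : R[i] -> R[i], holo_disc f ->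
    forall z : R[i], disc z ->
      word_op g w f z =
        (1 - (delta_word w)%:R) * opow (Sop g) (l + m) (opow (Top g) n f) z
      + (delta_word w)%:R * opow (Sop g) (l + m) (opow (Top g) n (Pi0 f)) z
      + \sum_(1 <= j < (l + m).+1)
          (a j)%:~R * opow (Sop g) (l + m - j) (opow (Top g) (n + j) f) z
      + \sum_(1 <= j < (l + m).+1)
          (b j)%:~R * opow (Sop g) (l + m - j) (opow (Top g) (n + j) (Pi0 f)) z)
  /\
  (exists c : nat -> int,
    forall g : R[i] -> R[i], holo_disc g ->
    forall f : R[i] -> R[i], holo_disc f -> f 0 = 0 ->
    forall z : R[i], disc z ->
      word_op g w f z =
        opow (Sop g) (l + m) (opow (Top g) n f) z
      + \sum_(1 <= j < (l + m).+1)
          (c j)%:~R * opow (Sop g) (l + m - j) (opow (Top g) (n + j) f) z).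
Proof.
move=> hl hm hn mn _.
have [a [b [a0 b0 _ h]]] : has_normal_form (R := R) (delta_word w) w (l + m) n.
  rewrite -hl -hm -hn -count_nonT; apply: word_has_normal_form.
  by rewrite count_nonM hm hn.
have main (g : R[i] -> R[i]) : holo_disc g -> forall f, holo_disc f -> forall z, disc z ->
    word_op g w f z =
        (1 - (delta_word w)%:R) * opow (Sop g) (l + m) (opow (Top g) n f) z
      + (delta_word w)%:R * opow (Sop g) (l + m) (opow (Top g) n (Pi0 f)) z
      + \sum_(1 <= j < (l + m).+1)
          (a j)%:~R * opow (Sop g) (l + m - j) (opow (Top g) (n + j) f) z
      + \sum_(1 <= j < (l + m).+1)
          (b j)%:~R * opow (Sop g) (l + m - j) (opow (Top g) (n + j) (Pi0 f)) z.
  move=> hg f hf z /discE hz.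
  have hP := holo_Pi0 hf.
  have := h (gops_of hg) f hf z hz.
  rewrite (normal_form_sum (o := gops_of hg) _ _ _ hf hz).
  rewrite (normal_form_sum (o := gops_of hg) _ _ _ hP hz).
  (* The terms of index 0 are split off from both sums; their coefficients are [1 - delta] and
     [delta]. *)
  rewrite !(big_ltn (ltn0Sn (l + m))) a0 b0 !subn0 !addn0 rmorphB rmorph1 !pmulrn.
  by move=> e; apply: (etrans e); rewrite mul1r -!addrA; congr (_ + _); rewrite addrCA.
split; first by exists a, b.
(* On functions vanishing at 0, [Pi0] is the identity: the two sums merge and the leading
   coefficients add up to 1. *)
exists (fun j => a j + b j) => g hg f hf f0 z hz.
have Pf : Pi0 f = f by apply/funext => x; rewrite /Pi0 f0 subr0.
rewrite (main g hg f hf z hz) Pf -mulrDl subrK mul1r -addrA -big_split /=.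
by congr (_ + _); apply: eq_bigr => j _; rewrite rmorphD mulrDl.
Qed.
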